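(* A partial groupoid $X$ is embeddable if and only if for every $n$ and each compatible pair $T,T'$ of triangulations of an $(n+1)$-gon, any map $\mathrm{NA}^{T,T'}\to X$ identifies the two long edges $0\to n$ of $\mathrm{NA}^{T,T'}$.
   Context: Let $\Upsilon$ be the category whose objects are the sets $[n]=\{0,1,\dots,n\}$, $n\ge 0$, with arbitrary functions as morphisms. A symmetric set is a functor $X\colon \Upsilon^{\mathrm{op}}\to \mathsf{Set}$, with $X_n=X([n])$; maps are natural transformations. The Segal map sends $x\in X_n$ to the word of its principal edges (restrictions to $\{i-1,i\}$, $1\le i\le n$) in $X_1\times_{X_0}\cdots\times_{X_0}X_1$. $X$ is spiny if the Segal map is injective for all $n\ge1$. A partial groupoid is a spiny symmetric set. $N\colon\mathsf{Gpd}\to\mathsf{Sym}$ is the nerve functor, where $(NG)_n$ is the set of functors to $G$ from the groupoid with object set $[n]$ and exactly one morphism between any two objects; $\tau$ is its left adjoint. A partial groupoid $X$ is embeddable if the unit map $X\to N\tau X$ is a monomorphism. $\Upsilon^n=\hom_\Upsilon(-,[n])$ is the representable symmetric set. The spine $\mathrm{Sp}^n\subseteq\Upsilon^n$ consists of those functions $[m]\to[n]$ whose image lies in $\{i,i+1\}$ for some $i$. The vertices of the regular $(n+1)$-gon ($n\ge2$) are labelled $0,1,\dots,n$ in cyclic order. A triangulation $T$ (using only the vertices of the polygon) is regarded as the set of triples $(i,j,k)$, $i<j<k$, of vertices of its triangles. $H(T)\subseteq\Upsilon^n$ is the symmetric subset of those functions $[m]\to[n]$ whose image is contained in $\{i,j,k\}$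 for some $(i,j,k)\in T$; it contains $\mathrm{Sp}^n$. The pair $T,T'$ is compatible if the pushout of symmetric sets $H(T)\amalg_{\mathrm{Sp}^n}H(T')$ is spiny, and in this case this partial groupoid is denoted $\mathrm{NA}^{T,T'}$. Its two long edges $0\to n$ are the images of the edge $0\to n$ of $H(T)$ and of the edge $0\to n$ of $H(T')$. *)

(* Defs.v *)
From Stdlib Require Import Relation_Operators.
From HB Require Import structures.
From mathcomp Require Import all_boot zify.
From mathcomp.classical Require Import boolp.

Set Implicit Arguments.
Unset Strict Implicit.
Unset Printing Implicit Defensive.

Local Open Scope quotient_scope.

(* The quotient of T by the equivalence relation generated by R. *)
Section Quotient.
Variables (T : Type) (R : T -> T -> Prop).

Definition gen_equiv (x y : {classic T}) : bool :=
  `[< clos_refl_sym_trans T R x y >].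

Lemma gen_equiv_refl : reflexive gen_equiv.
Proof. by move=> x; apply/asboolP; apply: rst_refl. Qed.

Lemma gen_equiv_sym : symmetric gen_equiv.
Proof. by move=> x y; apply/asboolP/asboolP; apply: rst_sym. Qed.

Lemma gen_equiv_trans : transitive gen_equiv.
Proof.
by move=> y x z /asboolP xy /asboolP yz; apply/asboolP; apply: rst_trans yz.
Qed.

Canonical gen_equivRel :=
  EquivRel gen_equiv gen_equiv_refl gen_equiv_sym gen_equiv_trans.

Definition quot : Type := {eq_quot gen_equivRel}.
Definition cls (x : T) : quot := \pi_({eq_quot gen_equivRel}) (x : {classic T}).
Definition quot_repr (q : quot) : T := repr (q : {eq_quot gen_equivRel}).

Lemma quot_reprK q : cls (quot_repr q) = q.
Proof. exact: reprK. Qed.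

Lemma cls_eqP x y : cls x = cls y <-> clos_refl_sym_trans T R x y.
Proof. by split=> [/eqmodP/asboolP //|xy]; apply/eqmodP/asboolP. Qed.

Lemma cls_eq x y : R x y -> cls x = cls y.
Proof. by move=> xy; apply/cls_eqP; apply: rst_step. Qed.

Lemma quotE (P : quot -> Prop) : (forall x, P (cls x)) -> forall q, P q.
Proof. by move=> Pc q; rewrite -[q]quot_reprK. Qed.

Lemma clos_invariant (S : Type) (f : T -> S) :
  (forall x y, R x y -> f x = f y) ->
  forall x y, clos_refl_sym_trans T R x y -> f x = f y.
Proof. by move=> fR x y; elim=> [u v /fR|||u v w _ -> _ ->]. Qed.

Lemma quot_repr_cls (S : Type) (f : T -> S) :
  (forall x y, R x y -> f x = f y) -> forall x, f (quot_repr (cls x)) = f x.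
Proof.
by move=> fR x; apply: (clos_invariant fR); apply/cls_eqP; rewrite quot_reprK.
Qed.

End Quotient.

(* The object [n] = {0, ..., n} of the indexing category is 'I_n.+1, and its
   morphisms are all functions. *)
Record symset := SymSet {
  simplex :> nat -> Type;
  restr : forall m n : nat, ('I_m.+1 -> 'I_n.+1) -> simplex n -> simplex m;
  restr_id : forall n (x : simplex n), restr (fun i => i) x = x;
  restr_comp : forall l m n (f : 'I_l.+1 -> 'I_m.+1) (g : 'I_m.+1 -> 'I_n.+1)
    (x : simplex n), restr (g \o f) x = restr f (restr g x) }.

Record symmap (X Y : symset) := SymMap {
  symapp :> forall n, X n -> Y n;
  symapp_restr : forall m n (f : 'I_m.+1 -> 'I_n.+1) (x : X n),
    symapp (restr f x) = restr f (symapp x) }.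

Lemma symmap_eq (X Y : symset) (f g : symmap X Y) :
  (forall n (x : X n), f n x = g n x) -> f = g.
Proof.
case: f g => [f fr] [g gr] /= fg.
have E : f = g by apply: functional_extensionality_dep => n; apply: funext.
by case: _ / E gr {fg} => gr; congr SymMap; apply: Prop_irrelevance.
Qed.

Program Definition symcomp (X Y Z : symset) (g : symmap Y Z) (f : symmap X Y) :
  symmap X Z := @SymMap X Z (fun n x => g n (f n x)) _.
Next Obligation. by rewrite /= !symapp_restr. Qed.

Definition monomorphism (X Y : symset) (f : symmap X Y) : Prop :=
  forall (Z : symset) (g h : symmap Z X), symcomp f g = symcomp f h -> g = h.

Section Spiny.
Variable X : symset.

Definition vmap n (i : 'I_n.+1) : 'I_1 -> 'I_n.+1 := fun=> i.
Definition emap n (i j : 'I_n.+1) : 'I_2 -> 'I_n.+1 :=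
  fun k => if k == ord0 then i else j.
Definition tmap n (i j k : 'I_n.+1) : 'I_3 -> 'I_n.+1 :=
  fun l => if l == ord0 then i else if l == ord_max then k else j.

Definition vertex n (i : 'I_n.+1) (x : X n) : X 0 := restr (vmap i) x.
Definition edge n (i j : 'I_n.+1) (x : X n) : X 1 := restr (emap i j) x.

Definition source (e : X 1) : X 0 := vertex ord0 e.
Definition target (e : X 1) : X 0 := vertex ord_max e.

(* The iterated fibre product X_1 x_{X_0} ... x_{X_0} X_1 with n factors. *)
Definition composable n (w : 'I_n -> X 1) : Prop :=
  forall i j : 'I_n, j = i.+1 :> nat -> target (w i) = source (w j).
Definition segal_words n : Type := {w : 'I_n -> X 1 | composable w}.

Lemma source_edge n (i j : 'I_n.+1) (x : X n) :
  source (edge i j x) = vertex i x.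
Proof. by rewrite /source /vertex /edge -restr_comp. Qed.

Lemma target_edge n (i j : 'I_n.+1) (x : X n) :
  target (edge i j x) = vertex j x.
Proof. by rewrite /target /vertex /edge -restr_comp. Qed.

(* [i : 'I_n] indexes the principal edge {i, i+1}. *)
Definition principal_edge n (x : X n) (i : 'I_n) : X 1 :=
  edge (widen_ord (leqnSn n) i) (lift ord0 i) x.

Lemma principal_edge_composable n (x : X n) : composable (principal_edge x).
Proof.
move=> i j ji; rewrite /principal_edge target_edge source_edge.
by congr vertex; apply: val_inj; rewrite /= ji.
Qed.

Definition segal n (x : X n) : segal_words n :=
  exist _ (principal_edge x) (principal_edge_composable x).

Definition spiny : Prop := forall n, 0 < n -> injective (@segal n).

End Spiny.

Record partial_groupoid := PartialGroupoid {
  pg_symset :> symset;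
  pg_spiny : spiny pg_symset }.

(* Composition is written in diagrammatic order. *)
Record groupoid := Groupoid {
  gob :> Type;
  gmor : gob -> gob -> Type;
  gid : forall x, gmor x x;
  gcomp : forall x y z, gmor x y -> gmor y z -> gmor x z;
  ginv : forall x y, gmor x y -> gmor y x;
  gcomp_idl : forall x y (h : gmor x y), gcomp (gid x) h = h;
  gcomp_idr : forall x y (h : gmor x y), gcomp h (gid y) = h;
  gcompA : forall x y z t (h : gmor x y) (k : gmor y z) (l : gmor z t),
    gcomp h (gcomp k l) = gcomp (gcomp h k) l;
  gcomp_invr : forall x y (h : gmor x y), gcomp h (ginv h) = gid x;
  gcomp_invl : forall x y (h : gmor x y), gcomp (ginv h) h = gid y }.

Record functor (G H : groupoid) := Functor {
  fob :> G -> H;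
  fmor : forall x y, gmor x y -> gmor (fob x) (fob y);
  fmor_id : forall x, fmor (gid x) = gid (fob x);
  fmor_comp : forall x y z (h : gmor x y) (k : gmor y z),
    fmor (gcomp h k) = gcomp (fmor h) (fmor k) }.

Program Definition functor_comp (G H K : groupoid)
    (F : functor G H) (F' : functor H K) : functor G K :=
  @Functor G K (fun x => F' (F x)) (fun x y h => fmor F' (fmor F h)) _ _.
Next Obligation. by rewrite !fmor_id. Qed.
Next Obligation. by rewrite !fmor_comp. Qed.

(* The groupoid with exactly one morphism between any two elements of [A]. *)
Program Definition codiscrete (A : Type) : groupoid :=
  @Groupoid A (fun _ _ => unit) (fun=> tt) (fun _ _ _ _ _ => tt)
    (fun _ _ _ => tt) _ _ _ _ _.
Next Obligation. by case: h. Qed.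
Next Obligation. by case: h. Qed.

Definition codiscrete_map (A B : Type) (f : A -> B) :
    functor (codiscrete A) (codiscrete B) :=
  @Functor (codiscrete A) (codiscrete B) f (fun _ _ u => u)
    (fun=> erefl) (fun _ _ _ _ _ => erefl).

(* Morphisms with unspecified endpoints, to compare morphisms whose endpoints
   are only propositionally equal. *)
Record arrow (G : groupoid) := Arrow {
  arr_src : G; arr_tgt : G; arr_mor : gmor arr_src arr_tgt }.

Definition gcast (G : groupoid) (a a' b b' : G) (ea : a = a') (eb : b = b')
    (h : gmor a b) : gmor a' b' :=
  match ea in _ = x, eb in _ = y return gmor x y with
  | erefl, erefl => h
  end.

Lemma arrow_gcast (G : groupoid) (a a' b b' : G) (ea : a = a') (eb : b = b')
  (h : gmor a b) : Arrow (gcast ea eb h) = Arrow h.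
Proof. by case: _ / ea; case: _ / eb. Qed.

Lemma arrow_inj (G : groupoid) (a b : G) (h k : gmor a b) :
  Arrow h = Arrow k -> h = k.
Proof.
move=> E.
have H A (e : Arrow k = A) : gcast (esym (congr1 (@arr_src G) e))
    (esym (congr1 (@arr_tgt G) e)) (arr_mor A) = k.
  by case: _ / e.
rewrite -(H _ (esym E)) /=; set ea := esym _; set eb := esym _.
by rewrite (Prop_irrelevance ea erefl) (Prop_irrelevance eb erefl).
Qed.

Lemma arrow_comp (G : groupoid) (a b c a' b' c' : G) (h : gmor a b)
  (k : gmor b c) (h' : gmor a' b') (k' : gmor b' c') :
  Arrow h = Arrow h' -> Arrow k = Arrow k' ->
  Arrow (gcomp h k) = Arrow (gcomp h' k').
Proof.
move=> eh ek.
have ea : a' = a := esym (congr1 (@arr_src G) eh).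
have eb : b' = b := esym (congr1 (@arr_tgt G) eh).
have ec : c' = c := esym (congr1 (@arr_tgt G) ek).
move: h' k' eh ek; rewrite ea eb ec => h' k' eh ek.
by rewrite (arrow_inj eh) (arrow_inj ek).
Qed.

Lemma arrow_functor (G H : groupoid) (F : functor G H) (a b a' b' : G)
  (h : gmor a b) (h' : gmor a' b') :
  Arrow h = Arrow h' -> Arrow (fmor F h) = Arrow (fmor F h').
Proof. exact: (congr1 (fun A => Arrow (fmor F (arr_mor A)))). Qed.

Lemma functor_eq (G H : groupoid) (F F' : functor G H) :
  (forall x y (h : gmor x y), Arrow (fmor F h) = Arrow (fmor F' h)) -> F = F'.
Proof.
move=> E.
have Eo : fob F = fob F'.
  by apply: funext => x; have /(congr1 (@arr_src H)) := E x x (gid x).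
case: F F' Eo E => [o m i c] [o' m' i' c'] /= Eo.
case: _ / Eo m' i' c' => m' i' c' E.
have Em : m = m'.
  apply: functional_extensionality_dep => x.
  apply: functional_extensionality_dep => y; apply: funext => h.
  exact: arrow_inj (E x y h).
case: _ / Em i' c' {E} => i' c'.
by congr Functor; apply: Prop_irrelevance.
Qed.

Program Definition nerve (G : groupoid) : symset :=
  @SymSet (fun n => functor (codiscrete 'I_n.+1) G)
    (fun m n f F => functor_comp (codiscrete_map f) F) _ _.
Next Obligation. exact: functor_eq. Qed.
Next Obligation. exact: functor_eq. Qed.

Program Definition nerve_map (G H : groupoid) (F : functor G H) :
    symmap (nerve G) (nerve H) :=
  @SymMap (nerve G) (nerve H) (fun n c => functor_comp c F) _.
Next Obligation. exact: functor_eq. Qed.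

(* [tau X] is presented by generators and relations: objects are the vertices
   of [X]; morphisms are composable words of edges, modulo the relations
   "t01 t12 = t02" for each 2-simplex [t] and "degenerate edge = empty word".
   Lemma [tau_universal] below shows that [tau_unit X] is a universal arrow
   from [X] to the nerve functor, i.e. that [tau] is the left adjoint of
   [nerve] and [tau_unit] the unit of the adjunction. *)
Section Tau.
Variable X : symset.

Definition edge_between (x y : X 0) : Type :=
  {e : X 1 | source e = x /\ target e = y}.

Definition mk_edge n (i j : 'I_n.+1) (s : X n) :
    edge_between (vertex i s) (vertex j s) :=
  exist _ (edge i j s) (conj (source_edge i j s) (target_edge i j s)).

Inductive epath (z : X 0) : X 0 -> Type :=
| pnil : epath z z
| pcons x y (e : edge_between x y) (p : epath z y) : epath z x.

Inductive epath_step (z : X 0) : forall x, epath z x -> epath z x -> Prop :=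
| step_triangle x y w (e : edge_between x y) (f : edge_between y w)
    (g : edge_between x w) (t : X 2) (p : epath z w) :
    edge ord0 (lift ord0 ord0) t = sval e ->
    edge (lift ord0 ord0) ord_max t = sval f ->
    edge ord0 ord_max t = sval g ->
    epath_step (pcons e (pcons f p)) (pcons g p)
| step_degenerate x (e : edge_between x x) (p : epath z x) :
    edge ord0 ord0 x = sval e -> epath_step (pcons e p) p
| step_pcons x y (e : edge_between x y) (p q : epath z y) :
    epath_step p q -> epath_step (pcons e p) (pcons e q).

Fixpoint pcat y z (q : epath z y) x (p : epath y x) : epath z x :=
  match p in epath _ x return epath z x with
  | pnil => q
  | pcons _ _ e p' => pcons e (pcat q p')
  end.

Lemma pcat_nil x y (p : epath y x) : pcat (pnil y) p = p.
Proof. by elim: p => //= u v e p ->. Qed.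

Lemma pcat_cat x y z t (p : epath y x) (q : epath z y) (r : epath t z) :
  pcat r (pcat q p) = pcat (pcat r q) p.
Proof. by elim: p q => //= u v e p IH q; rewrite IH. Qed.

Definition eflip x y (e : edge_between x y) : edge_between y x :=
  exist _ (edge ord_max ord0 (sval e))
    (conj (etrans (source_edge _ _ _) (proj2 (svalP e)))
          (etrans (target_edge _ _ _) (proj1 (svalP e)))).

Fixpoint prev y x (p : epath y x) : epath x y :=
  match p in epath _ x return epath x y with
  | pnil => pnil y
  | pcons _ _ e p' => pcat (pcons (eflip e) (pnil _)) (prev p')
  end.

Definition tau_mor (x y : X 0) : Type := quot (@epath_step y x).

Local Notation peq p q := (clos_refl_sym_trans _ (@epath_step _ _) p q).

Lemma peq_pcons z x y (e : edge_between x y) (p q : epath z y) :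
  peq p q -> peq (pcons e p) (pcons e q).
Proof.
elim=> [u v uv|u|u v _|u v w _ uv _ vw].
- exact/rst_step/step_pcons.
- exact: rst_refl.
- exact: rst_sym.
- exact: rst_trans uv vw.
Qed.

Lemma peq_pcatl x y z (p : epath y x) (q q' : epath z y) :
  peq q q' -> peq (pcat q p) (pcat q' p).
Proof. by move=> qq; elim: p q q' qq => //= u v e p IH q q' /IH /peq_pcons. Qed.

Lemma step_pcatr x y z (p p' : epath y x) (q : epath z y) :
  epath_step p p' -> epath_step (pcat q p) (pcat q p').
Proof.
move=> st; elim: st q => /= [u v w e f g t r t1 t2 t3|u e r d|u v e r r' _ IH] q.
- exact: step_triangle t1 t2 t3.
- exact: step_degenerate.
- exact: step_pcons.
Qed.

Lemma peq_pcatr x y z (p p' : epath y x) (q : epath z y) :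
  peq p p' -> peq (pcat q p) (pcat q p').
Proof.
elim=> [u v uv|u|u v _|u v w _ uv _ vw].
- exact/rst_step/step_pcatr.
- exact: rst_refl.
- exact: rst_sym.
- exact: rst_trans uv vw.
Qed.

Lemma edge_edge n (i j : 'I_n.+1) (k l : 'I_2) (s : X n) :
  edge k l (edge i j s) = edge (emap i j k) (emap i j l) s.
Proof.
rewrite /edge -restr_comp; congr restr; apply: funext => a /=.
by rewrite /emap; case: (a == ord0).
Qed.

Lemma edge_tmap n (i j k : 'I_n.+1) (a b : 'I_3) (s : X n) :
  edge a b (restr (tmap i j k) s) = edge (tmap i j k a) (tmap i j k b) s.
Proof.
rewrite /edge -restr_comp; congr restr; apply: funext => c /=.
by rewrite /emap; case: (c == ord0).
Qed.

Lemma edge_vertex n (i : 'I_n.+1) (s : X n) :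
  edge ord0 ord0 (vertex i s) = edge i i s.
Proof.
rewrite /edge /vertex -restr_comp; congr restr; apply: funext => c /=.
by rewrite /emap /vmap; case: (c == ord0).
Qed.

Lemma edge_id (e : X 1) : edge ord0 ord_max e = e.
Proof.
rewrite /edge -[RHS]restr_id; congr restr; apply: funext => -[[|[|//]] i] /=;
  exact: val_inj.
Qed.

Lemma vertex_id (x : X 0) (i : 'I_1) : vertex i x = x.
Proof.
rewrite /vertex -[RHS]restr_id; congr restr; apply: funext => j.
by rewrite /vmap !ord1.
Qed.

Lemma step_flip z x y (e : edge_between x y) (p : epath z x) :
  peq (pcons e (pcons (eflip e) p)) p.
Proof.
have ex : source (edge ord0 ord0 (sval e)) = x /\
          target (edge ord0 ord0 (sval e)) = x.
  by rewrite source_edge target_edge; case: (svalP e) => [].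
apply: (@rst_trans _ _ _ (pcons (exist _ _ ex : edge_between x x) p)).
  apply: rst_step.
  apply: (@step_triangle _ _ _ _ _ _ _ (restr (tmap ord0 ord_max ord0) (sval e)));
  by rewrite edge_tmap //= edge_id.
apply/rst_step/step_degenerate => /=.
by rewrite -(edge_vertex ord0 (sval e)) -/(source _) (proj1 (svalP e)).
Qed.

Lemma eflipK x y (e : edge_between x y) : eflip (eflip e) = e.
Proof.
case: e => e ex; apply: eq_exist => /=.
by rewrite edge_edge /emap /= edge_id.
Qed.

Lemma prev_cat x y z (p : epath y x) (q : epath z y) :
  prev (pcat q p) = pcat (prev p) (prev q).
Proof.
elim: p q => /= [q|u v e p IH q]; first by rewrite pcat_nil.
by rewrite IH pcat_cat.
Qed.

Lemma prevK x y (p : epath y x) : prev (prev p) = p.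
Proof. by elim: p => //= u v e p IH; rewrite prev_cat /= IH eflipK. Qed.

Lemma pcat_prev x y (p : epath y x) : peq (pcat (prev p) p) (pnil x).
Proof.
elim: p => /= [|u v e p IH]; first exact: rst_refl.
rewrite -pcat_cat.
apply: rst_trans (step_flip e _).
exact/peq_pcons/(peq_pcatr (pcons (eflip e) (pnil u)) IH).
Qed.

Definition tau_comp x y z (a : tau_mor x y) (b : tau_mor y z) : tau_mor x z :=
  cls (@epath_step z x) (pcat (quot_repr b) (quot_repr a)).

Definition tau_inv x y (a : tau_mor x y) : tau_mor y x :=
  cls (@epath_step x y) (prev (quot_repr a)).

Definition tau_id x : tau_mor x x := cls (@epath_step x x) (pnil x).

Lemma quot_repr_peq x y (p : epath y x) :
  peq (quot_repr (cls (@epath_step y x) p)) p.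
Proof. by apply/cls_eqP; rewrite quot_reprK. Qed.

Lemma tau_comp_cls x y z (p : epath y x) (q : epath z y) :
  tau_comp (cls (@epath_step y x) p) (cls (@epath_step z y) q) =
  cls (@epath_step z x) (pcat q p).
Proof.
apply/cls_eqP; apply: rst_trans (peq_pcatr _ (quot_repr_peq p)).
exact/peq_pcatl/quot_repr_peq.
Qed.

Program Definition tau : groupoid :=
  @Groupoid (X 0) tau_mor tau_id tau_comp tau_inv _ _ _ _ _.
Next Obligation.
by elim/quotE: h => p; rewrite tau_comp_cls.
Qed.
Next Obligation.
by elim/quotE: h => p; rewrite tau_comp_cls pcat_nil.
Qed.
Next Obligation.
elim/quotE: h => p; elim/quotE: k => q; elim/quotE: l => r.
by rewrite !tau_comp_cls pcat_cat.
Qed.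
Next Obligation.
by rewrite -{1}[h]quot_reprK tau_comp_cls; apply/cls_eqP/pcat_prev.
Qed.
Next Obligation.
rewrite -{2}[h]quot_reprK tau_comp_cls; apply/cls_eqP.
by rewrite -{1}[quot_repr h]prevK; apply: pcat_prev.
Qed.

Definition tau_edge x y (e : edge_between x y) : @gmor tau x y :=
  cls (@epath_step y x) (pcons e (pnil y)).

(* The simplex [s] of dimension [n] is sent to the functor mapping [i] to the
   [i]-th vertex of [s] and [i -> j] to the class of the edge {i, j} of [s]. *)
Program Definition tau_unit_functor n (s : X n) :
    functor (codiscrete 'I_n.+1) tau :=
  @Functor (codiscrete 'I_n.+1) tau (fun i => vertex i s)
    (fun i j _ => tau_edge (mk_edge i j s)) _ _.
Next Obligation.
by apply/cls_eq/step_degenerate; rewrite edge_vertex.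
Qed.
Next Obligation.
rewrite /= /tau_edge tau_comp_cls; apply/esym/cls_eq.
by apply: (@step_triangle _ _ _ _ _ _ _ (restr (tmap x y z) s));
  rewrite edge_tmap.
Qed.

Lemma edge_restr m n (f : 'I_m.+1 -> 'I_n.+1) (i j : 'I_m.+1) (s : X n) :
  edge i j (restr f s) = edge (f i) (f j) s.
Proof.
rewrite /edge -restr_comp; congr restr; apply: funext => c /=.
by rewrite /emap; case: (c == ord0).
Qed.

Lemma tau_edge_arrow x y x' y' (e : edge_between x y) (e' : edge_between x' y') :
  sval e = sval e' -> Arrow (tau_edge e) = Arrow (tau_edge e').
Proof.
case: e e' => e ex [e' ex'] /= ee; case: _ / ee ex' => ex'.
case: (ex) (ex) => ex1 ex2; case: _ / ex1; case: _ / ex2 => {}ex.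
case: (ex') (ex') => ex1 ex2; case: _ / ex1; case: _ / ex2 => {}ex'.
by rewrite (Prop_irrelevance ex ex').
Qed.

Program Definition tau_unit : symmap X (nerve tau) :=
  @SymMap X (nerve tau) tau_unit_functor _.
Next Obligation.
apply: functor_eq => i j u /=.
by apply: tau_edge_arrow => /=; rewrite edge_restr.
Qed.

End Tau.

Section TauUniversal.
Variables (X : symset) (G : groupoid) (f : symmap X (nerve G)).

Let fo (v : X 0) : G := (f 0 v : functor _ _) ord0.

Lemma ext_vertex n (i : 'I_n.+1) (s : X n) :
  (f n s : functor _ _) i = fo (vertex i s).
Proof. by rewrite /fo /vertex symapp_restr. Qed.

Lemma ext_source (e : X 1) x : source e = x ->
  (f 1 e : functor _ _) ord0 = fo x.
Proof. by move<-; apply: ext_vertex. Qed.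

Lemma ext_target (e : X 1) x : target e = x ->
  (f 1 e : functor _ _) ord_max = fo x.
Proof. by move<-; apply: ext_vertex. Qed.

Definition ext_edge x y (e : edge_between x y) : gmor (fo x) (fo y) :=
  gcast (ext_source (proj1 (svalP e))) (ext_target (proj2 (svalP e)))
    (@fmor _ _ (f 1 (sval e)) ord0 ord_max tt).

Lemma ext_edgeE x y (e : edge_between x y) n (i j : 'I_n.+1) (s : X n) :
  edge i j s = sval e ->
  Arrow (ext_edge e) = Arrow (@fmor _ _ (f n s) i j tt).
Proof. by move=> es; rewrite arrow_gcast -es /edge symapp_restr. Qed.

Fixpoint ext_path z x (p : epath z x) : gmor (fo x) (fo z) :=
  match p in epath _ x return gmor (fo x) (fo z) with
  | pnil => gid (fo z)
  | pcons _ _ e p' => gcomp (ext_edge e) (ext_path p')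
  end.

Lemma ext_path_step z x (p q : epath z x) :
  epath_step p q -> ext_path p = ext_path q.
Proof.
elim=> /= [u v w e d g t r te td tg|u e r d|u v e r r' _ -> //].
- rewrite gcompA; congr gcomp; apply: arrow_inj.
  rewrite (ext_edgeE tg) (arrow_comp (ext_edgeE te) (ext_edgeE td)).
  by rewrite -fmor_comp.
- rewrite -[RHS]gcomp_idl; congr gcomp; apply: arrow_inj.
  by rewrite (ext_edgeE d) (fmor_id (f 0 u)).
Qed.

Lemma ext_path_cat x y z (p : epath y x) (q : epath z y) :
  ext_path (pcat q p) = gcomp (ext_path p) (ext_path q).
Proof.
by elim: p q => /= [q|u v e p IH q]; rewrite ?gcomp_idl ?IH ?gcompA.
Qed.

Lemma ext_repr z x (p : epath z x) :
  ext_path (quot_repr (cls (@epath_step _ z x) p)) = ext_path p.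
Proof. exact: quot_repr_cls (@ext_path_step z x) p. Qed.

Program Definition tau_ext : functor (tau X) G :=
  @Functor (tau X) G fo (fun x y h => ext_path (quot_repr h)) _ _.
Next Obligation. by rewrite ext_repr. Qed.
Next Obligation. by rewrite ext_repr ext_path_cat. Qed.

Lemma tau_extP : symcomp (nerve_map tau_ext) (tau_unit X) = f.
Proof.
apply: symmap_eq => n s; apply: functor_eq => i j [] /=.
by rewrite ext_repr /= gcomp_idr; apply: ext_edgeE.
Qed.

Lemma tau_ext_unique (F : functor (tau X) G) :
  symcomp (nerve_map F) (tau_unit X) = f -> tau_ext = F.
Proof.
move=> Ff.
have Fe x y (e : edge_between x y) :
    Arrow (ext_edge e) = Arrow (fmor F (tau_edge e)).
  rewrite (ext_edgeE (edge_id (sval e))) -Ff /=.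
  by apply/arrow_functor/tau_edge_arrow; rewrite /= edge_id.
have Fo x : fo x = F x.
  have ex : source (edge ord0 ord0 x) = x /\ target (edge ord0 ord0 x) = x.
    by rewrite source_edge target_edge vertex_id.
  exact: (congr1 (@arr_src G) (Fe x x (exist _ _ ex))).
apply: functor_eq => x y h /=; elim/quotE: h => p; rewrite ext_repr.
elim: p => /= [|u v e p IH].
  by rewrite -/(tau_id y) (fmor_id F) Fo.
rewrite (arrow_comp (Fe _ _ e) IH) -fmor_comp /= /tau_edge tau_comp_cls.
by [].
Qed.

End TauUniversal.

Theorem tau_universal (X : symset) (G : groupoid) (f : symmap X (nerve G)) :
  exists! F : functor (tau X) G, symcomp (nerve_map F) (tau_unit X) = f.
Proof.
exists (tau_ext f); split; [exact: tau_extP | exact: tau_ext_unique].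
Qed.

Definition embeddable (X : partial_groupoid) : Prop :=
  monomorphism (tau_unit X).

Section Pushout.
Variables (A B C : symset) (f : symmap A B) (g : symmap A C).

Inductive glue n : B n + C n -> B n + C n -> Prop :=
| glue_intro (a : A n) : glue (inl (f n a)) (inr (g n a)).

Definition sum_restr m n (h : 'I_m.+1 -> 'I_n.+1) (x : B n + C n) :
    B m + C m :=
  match x with inl b => inl (restr h b) | inr c => inr (restr h c) end.

Definition pushout_restr m n (h : 'I_m.+1 -> 'I_n.+1) (x : quot (@glue n)) :
  quot (@glue m) := cls (@glue m) (sum_restr h (quot_repr x)).

Lemma pushout_restr_cls m n (h : 'I_m.+1 -> 'I_n.+1) (x : B n + C n) :
  pushout_restr h (cls (@glue n) x) = cls (@glue m) (sum_restr h x).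
Proof.
pose k y := cls (@glue m) (sum_restr h y).
apply: (@quot_repr_cls _ (@glue n) _ k) => _ _ [a].
by apply: cls_eq => /=; rewrite -!symapp_restr.
Qed.

Program Definition pushout : symset :=
  @SymSet (fun n => quot (@glue n)) pushout_restr _ _.
Next Obligation.
by elim/quotE: x => -[b|c]; rewrite pushout_restr_cls /= restr_id.
Qed.
Next Obligation.
by elim/quotE: x => -[b|c]; rewrite !pushout_restr_cls /= restr_comp.
Qed.

Program Definition pushout_inl : symmap B pushout :=
  @SymMap B pushout (fun n b => cls (@glue n) (inl b)) _.
Next Obligation. by rewrite pushout_restr_cls. Qed.

Program Definition pushout_inr : symmap C pushout :=
  @SymMap C pushout (fun n c => cls (@glue n) (inr c)) _.
Next Obligation. by rewrite pushout_restr_cls. Qed.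

Lemma pushout_square : symcomp pushout_inl f = symcomp pushout_inr g.
Proof. by apply: symmap_eq => n a; apply: cls_eq. Qed.

Theorem pushout_universal (Z : symset) (u : symmap B Z) (v : symmap C Z) :
  symcomp u f = symcomp v g ->
  exists! w : symmap pushout Z,
    symcomp w pushout_inl = u /\ symcomp w pushout_inr = v.
Proof.
move=> uv.
pose k n (x : B n + C n) := match x with inl b => u n b | inr c => v n c end.
have kE n x : k n (quot_repr (cls (@glue n) x)) = k n x.
  apply: quot_repr_cls => _ _ [a] /=.
  exact: (congr1 (fun h : symmap A Z => h n a) uv).
have kr m n (h : 'I_m.+1 -> 'I_n.+1) (x : pushout n) :
    k m (quot_repr (restr h x)) = restr h (k n (quot_repr x)).
  elim/quotE: x => x; rewrite /= pushout_restr_cls !kE.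
  by case: x => y; rewrite /= symapp_restr.
exists (@SymMap pushout Z (fun n x => k n (quot_repr x)) kr); split.
  by split; apply: symmap_eq => n x; apply: kE.
move=> w [wu wv]; apply: symmap_eq => n x /=.
by elim/quotE: x => -[b|c]; rewrite kE /= -?wu -?wv.
Qed.

End Pushout.

Program Definition representable (n : nat) : symset :=
  @SymSet (fun m => 'I_m.+1 -> 'I_n.+1) (fun l m h s => s \o h) _ _.

Section SubSymset.
Variables (X : symset) (P : forall m, X m -> Prop).
Hypothesis P_restr : forall l m (h : 'I_l.+1 -> 'I_m.+1) (x : X m),
  P x -> P (restr h x).

Program Definition sub_symset : symset :=
  @SymSet (fun m => {x : X m | P x})
    (fun l m h s => exist _ (restr h (sval s)) (P_restr h (svalP s))) _ _.
Next Obligation. by apply: eq_exist; rewrite restr_id. Qed.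
Next Obligation. by apply: eq_exist; rewrite restr_comp. Qed.

End SubSymset.

Program Definition sub_incl (X : symset) (P Q : forall m, X m -> Prop)
    (Pr : forall l m (h : 'I_l.+1 -> 'I_m.+1) x, P m x -> P l (restr h x))
    (Qr : forall l m (h : 'I_l.+1 -> 'I_m.+1) x, Q m x -> Q l (restr h x))
    (PQ : forall m x, P m x -> Q m x) :
    symmap (sub_symset Pr) (sub_symset Qr) :=
  @SymMap (sub_symset Pr) (sub_symset Qr)
    (fun m s => exist _ (sval s) (PQ m (sval s) (svalP s))) _.
Next Obligation. exact: eq_exist. Qed.

Definition in_spine n m (s : representable n m) : Prop :=
  exists i : 'I_n, forall k, s k = i :> nat \/ s k = i.+1 :> nat.

Lemma in_spine_restr n l m (h : 'I_l.+1 -> 'I_m.+1) (s : representable n m) :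
  in_spine s -> in_spine (restr h s).
Proof. by case=> i si; exists i => k; apply: si. Qed.

Definition spine n : symset := sub_symset (@in_spine_restr n).

(* A chord of the polygon is a pair (a, b) of vertices with a < b; it is either
   a side or a diagonal. *)
Definition side n (a b : 'I_n.+1) : bool :=
  (b == a.+1 :> nat) || (a == 0 :> nat) && (b == n :> nat).

Definition diagonal n (d : 'I_n.+1 * 'I_n.+1) : bool :=
  (d.1 < d.2) && ~~ side d.1 d.2.

Definition crossing n (d e : 'I_n.+1 * 'I_n.+1) : bool :=
  (d.1 < e.1 < d.2) && (d.2 < e.2) || (e.1 < d.1 < e.2) && (e.2 < d.2).

(* A triangulation of the (n+1)-gon is given by its set of diagonals, a maximal
   set of pairwise non-crossing diagonals. *)
Record triangulation (n : nat) := Triangulation {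
  polygon_size : 2 <= n;
  diags : {set 'I_n.+1 * 'I_n.+1};
  diags_diagonal : forall d, d \in diags -> diagonal d;
  diags_noncrossing : forall d e, d \in diags -> e \in diags -> ~~ crossing d e;
  diags_maximal : forall d, diagonal d ->
    (forall e, e \in diags -> ~~ crossing d e) -> d \in diags }.

Section Triangles.
Variables (n : nat) (T : triangulation n).

Definition tri_edge (a b : 'I_n.+1) : bool := side a b || ((a, b) \in diags T).

(* The polygon being convex, three vertices span a triangle of the
   triangulation exactly when they are pairwise joined by sides or diagonals of
   the triangulation. *)
Definition triangles : {set 'I_n.+1 * 'I_n.+1 * 'I_n.+1} :=
  [set t : 'I_n.+1 * 'I_n.+1 * 'I_n.+1 | [&& t.1.1 < t.1.2, t.1.2 < t.2,
    tri_edge t.1.1 t.1.2, tri_edge t.1.2 t.2 & tri_edge t.1.1 t.2]].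

Definition in_triangles m (s : representable n m) : Prop :=
  exists2 t, t \in triangles & forall k, s k \in [:: t.1.1; t.1.2; t.2].

Lemma in_triangles_restr l m (h : 'I_l.+1 -> 'I_m.+1) (s : representable n m) :
  in_triangles s -> in_triangles (restr h s).
Proof. by case=> t tT st; exists t => // k; apply: st. Qed.

(* This is H(T). *)
Definition tri_symset : symset := sub_symset in_triangles_restr.

Lemma tri_edge_noncrossing (a b c d : 'I_n.+1) :
  a < b -> c < d -> tri_edge a b -> tri_edge c d -> ~~ crossing (a, b) (c, d).
Proof.
move=> ab cd /orP[sab|Dab] /orP[scd|Dcd]; last exact: diags_noncrossing Dab Dcd.
all: move: sab || move: scd; rewrite /side /crossing /=.
all: have := ltn_ord b; have := ltn_ord d; lia.
Qed.

Lemma tri_edge_maximal (a b : 'I_n.+1) : a < b ->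
  (forall c d : 'I_n.+1, c < d -> tri_edge c d -> ~~ crossing (a, b) (c, d)) ->
  tri_edge a b.
Proof.
move=> ab ncr; rewrite /tri_edge; case: (boolP (side a b)) => //= nsab.
apply: diags_maximal => [|[c d] cdD]; first by rewrite /diagonal ab.
apply: ncr; first by have /andP[] := diags_diagonal cdD.
by rewrite /tri_edge cdD orbT.
Qed.

Lemma long_side_triangle :
  exists k : 'I_n.+1, (ord0, k, ord_max) \in triangles.
Proof.
have n2 := polygon_size T.
pose P (k : 'I_n.+1) := (0 < k < n) && tri_edge ord0 k.
have P1 : P (inord 1).
  rewrite /P /tri_edge /side inordK; last by lia.
  by apply/andP; split=> //; lia.
case: (@arg_maxnP _ (inord 1) P val P1) => k /andP[/andP[k0 kn] ek] kmax.
exists k; rewrite inE /= k0 kn ek /=; apply/andP; split; last first.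
  by rewrite /tri_edge /side /= eqxx orbT.
apply: tri_edge_maximal => // c d cd ecd; apply/negP => cr.
have := tri_edge_noncrossing (k0 : (ord0 : 'I_n.+1) < k) cd ek ecd.
have := kmax d; rewrite /P; move: cr; rewrite /crossing /=.
have dn := ltn_ord d.
case: (posnP c) => [c0|c0]; last by lia.
have -> : ord0 = c by exact: val_inj.
rewrite ecd; lia.
Qed.

Lemma short_side_triangle (i j : 'I_n.+1) : j = i.+1 :> nat ->
  exists k : 'I_n.+1, [\/ (k, i, j) \in triangles | (i, j, k) \in triangles].
Proof.
move=> ji; have n2 := polygon_size T; have jn := ltn_ord j.
have ij : i < j by lia.
have eij : tri_edge i j by rewrite /tri_edge /side ji eqxx.
case: (pickP (fun k : 'I_n.+1 => (j < k) && tri_edge i k)) => [k0 Pk0|noP].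
  case: (@arg_minnP _ k0 (fun k : 'I_n.+1 => (j < k) && tri_edge i k) val Pk0)
    => k /andP[jk ek] kmin.
  have ik : i < k by lia.
  exists k; right; rewrite inE /= ij jk eij ek /= andbT.
  apply: tri_edge_maximal => // c d cd ecd; apply/negP => cr.
  have := tri_edge_noncrossing ik cd ek ecd.
  have := kmin d; move: cr; rewrite /crossing /=.
  case: (eqVneq c i) => [ci|/eqP ci].
    by have /= vi := congr1 val ci; rewrite -ci ecd; lia.
  have {}ci : c <> i :> nat by move/val_inj.
  lia.
have i0 : 0 < i.
  rewrite lt0n; apply/negP => /eqP i0; have := noP ord_max.
  by rewrite /tri_edge /side /= i0 !eqxx /= orbT; lia.
have Pi1 : ((inord i.-1 : 'I_n.+1) < i) && tri_edge (inord i.-1) i.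
  rewrite /tri_edge /side inordK; last by have := ltn_ord i; lia.
  by apply/andP; split; [lia | rewrite prednK ?eqxx].
case: (@arg_minnP _ _ (fun k : 'I_n.+1 => (k < i) && tri_edge k i) val Pi1)
  => k /andP[ki ek] kmin.
have kj : k < j by lia.
exists k; left; rewrite inE /= ki ij ek eij /=.
apply: tri_edge_maximal => // c d cd ecd; apply/negP => cr.
have := tri_edge_noncrossing ki cd ek ecd.
have := kmin c; have := noP d; move: cr; rewrite /crossing /=.
case: (eqVneq c i) => [ci|/eqP ci].
  by have /= vi := congr1 val ci; rewrite -ci ecd; lia.
have {}ci : c <> i :> nat by move/val_inj.
case: (eqVneq d i) => [di|/eqP di].
  by have /= vi := congr1 val di; rewrite -di ecd; lia.
have {}di : d <> i :> nat by move/val_inj.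
lia.
Qed.

Lemma in_spine_triangles m (s : representable n m) :
  in_spine s -> in_triangles s.
Proof.
case=> i si; pose a := widen_ord (leqnSn n) i; pose b := lift ord0 i.
have sab k : s k = a \/ s k = b.
  by case: (si k) => ki; [left|right]; apply: val_inj; rewrite /= ki.
have [k [kT|kT]] := @short_side_triangle a b erefl.
  by exists (k, a, b) => // l; rewrite !inE; case: (sab l) => ->;
     rewrite eqxx ?orbT.
by exists (a, b, k) => // l; rewrite !inE; case: (sab l) => ->;
   rewrite eqxx ?orbT.
Qed.

Definition spine_incl : symmap (spine n) tri_symset :=
  sub_incl (@in_spine_restr n) in_triangles_restr in_spine_triangles.

Lemma long_edge_in_triangles :
  @in_triangles 1 (emap (@ord0 n) (@ord_max n)).
Proof.
have [k kT] := long_side_triangle; exists (ord0, k, ord_max) => // l.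
by rewrite !inE /emap; case: (l == ord0); rewrite eqxx ?orbT.
Qed.

Definition long_edge : tri_symset 1 :=
  exist _ (emap (@ord0 n) (@ord_max n)) long_edge_in_triangles.

End Triangles.

Section NonAssociativity.
Variables (n : nat) (T T' : triangulation n).

Definition glued_triangulations : symset :=
  pushout (spine_incl T) (spine_incl T').

Definition compatible : Prop := spiny glued_triangulations.

Definition NA (c : compatible) : partial_groupoid := PartialGroupoid c.

Definition long_edge_l : glued_triangulations 1 :=
  pushout_inl (spine_incl T) (spine_incl T') 1 (long_edge T).

Definition long_edge_r : glued_triangulations 1 :=
  pushout_inr (spine_incl T) (spine_incl T') 1 (long_edge T').

End NonAssociativity.

(* Main.v *)
From Stdlib Require Import Relation_Operators.
From mathcomp Require Import all_boot zify.
From mathcomp.classical Require Import boolp.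
Require Import Defs.

(** A pasting in a symmetric set X is a binary tree of 2-simplices: its leaves
    form a word of edges, its root is one edge, and each node is a 2-simplex
    saying that two consecutive edges have a composite. It is the same thing as
    a map into X from a triangulated polygon: the leaves are the images of the
    sides 01, 12, ... and the root is the image of the long edge. The theorem
    follows from two facts about pairs of pastings with the same leaves.

    1. In any symmetric set, two parallel edges have the same image in the
    groupoid tau X if and only if they are the roots of two pastings with the
    same leaves ([tau_edge_eqP]). From right to left, the root of a pasting is
    the product of its leaves in tau X. From left to right, equality in tau X
    is a zigzag of elementary moves on words of edges; up to degenerate edges
    each move replaces one edge by two edges that span a 2-simplex with it, or
    the reverse. The zigzag can be rearranged as expansions followed by
    contractions because expansion is confluent ([pasting_confluence]):
    inverses of edges are available in a symmetric set, so that an edge c = ab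
    that is already expanded differently, say to a word A, still leads to a
    common expansion, since A expands to a a^-1 A and a^-1 A is an expansion of
    b = a^-1 c.

    2. If X is spiny and maps from all the partial groupoids NA identify the
    two long edges, then two pastings with the same leaves have the same root
    ([root_same_leaves]). The obstruction to gluing two triangulations into a
    spiny symmetric set is a common ear, a triangle (i, i+1, i+2) in both of
    them ([no_common_ear_compatible]). When the two pastings have a common ear,
    spininess forces the two 2-simplices placed there to agree, so that the ear
    can be cut off both pastings and the words get shorter. When there is none,
    the two pastings are a map from some NA to X, and the assumption applies.

    If X is embeddable, a map from NA to X gives two pastings with the same
    leaves whose roots are the images of the long edges
    ([long_edges_pastings]); they agree in tau X by 1, hence in X. Conversely,
    1 and 2 show that the unit is injective on edges, and a simplex of a spiny
    symmetric set is determined by its edges. *)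

Set Implicit Arguments.
Unset Strict Implicit.
Unset Printing Implicit Defensive.

Local Notation mid := (lift ord0 ord0 : 'I_3).

(** * Pastings and expansions of words *)

Section Pasting.
Variable X : symset.

Inductive pasting : Type :=
| Leaf of X 1
| Node of X 2 & pasting & pasting.

Fixpoint leaves (P : pasting) : seq (X 1) :=
  match P with Leaf e => [:: e] | Node _ l r => leaves l ++ leaves r end.

Definition root (P : pasting) : X 1 :=
  match P with Leaf e => e | Node t _ _ => edge ord0 ord_max t end.

Fixpoint wf (P : pasting) : Prop :=
  match P with
  | Leaf _ => True
  | Node t l r =>
    [/\ edge ord0 mid t = root l, edge mid ord_max t = root r, wf l & wf r]
  end.

Lemma size_leaves_gt0 P : 0 < size (leaves P).
Proof. by elim: P => //= t l IHl r IHr; rewrite size_cat; lia. Qed.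

Fixpoint walk (x : X 0) (w : seq (X 1)) (y : X 0) : Prop :=
  match w with
  | [::] => x = y
  | e :: w' => source e = x /\ walk (target e) w' y
  end.

Lemma walk_cat x y z w w' :
  walk x w y -> walk y w' z -> walk x (w ++ w') z.
Proof. by elim: w x => [x /= ->|e w IH x [ex /IH]] //= H /H. Qed.

Lemma walk_leaves P :
  wf P -> walk (source (root P)) (leaves P) (target (root P)).
Proof.
elim: P => //= t l IHl r IHr [tl tr /IHl wl /IHr wr].
rewrite source_edge target_edge.
apply: (@walk_cat _ (vertex mid t)).
  by move: wl; rewrite -tl source_edge target_edge.
by move: wr; rewrite -tr source_edge target_edge.
Qed.

(** Expansion is done in parallel on all letters, so that it splits along
    concatenations; a letter that does not change is expanded by a leaf. *)
Inductive expands : seq (X 1) -> seq (X 1) -> Prop :=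
| expands_nil : expands [::] [::]
| expands_cons P w w' :
    wf P -> expands w w' -> expands (root P :: w) (leaves P ++ w').

Lemma expands_inv w w' : expands w w' ->
  match w with
  | [::] => w' = [::]
  | e :: u => exists P u', [/\ wf P, root P = e, expands u u' & w' = leaves P ++ u']
  end.
Proof. by case=> // P u u' wfP uu'; exists P, u'. Qed.

Lemma expands_leaf e w w' : expands w w' -> expands (e :: w) (e :: w').
Proof. exact: (@expands_cons (Leaf e)). Qed.

Lemma expands_refl w : expands w w.
Proof. elim: w => [|e w]; [exact: expands_nil | exact: expands_leaf]. Qed.

Lemma expands_cat u u' w w' :
  expands u u' -> expands w w' -> expands (u ++ w) (u' ++ w').
Proof.
move=> uu' ww'; elim: uu' => //= P v v' wfP _ IH.
by rewrite -catA; apply: expands_cons.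
Qed.

Lemma expands_catl u w v : expands (u ++ w) v ->
  exists u' w', [/\ v = u' ++ w', expands u u' & expands w w'].
Proof.
elim: u v => [|e u IH] v /= ev.
  by exists [::], v; split=> //; exact: expands_nil.
have [P [v' [wfP <- /IH [u' [w' [-> uu' ww']]] ->]]] := expands_inv ev.
by exists (leaves P ++ u'), w'; rewrite catA; split=> //; apply: expands_cons.
Qed.

Lemma expands_root P : wf P -> expands [:: root P] (leaves P).
Proof. by rewrite -[leaves P]cats0 => wfP; apply: expands_cons expands_nil. Qed.

Lemma expands_triangle (t : X 2) :
  expands [:: edge ord0 ord_max t] [:: edge ord0 mid t; edge mid ord_max t].
Proof. exact: (@expands_root (Node t (Leaf _) (Leaf _))). Qed.

Lemma expands1 e w : expands [:: e] w ->
  exists P, [/\ wf P, root P = e & leaves P = w].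
Proof.
move/expands_inv=> [P [u [wfP rP /expands_inv -> ->]]].
by exists P; rewrite cats0.
Qed.

(** This is what makes expansion transitive. *)
Lemma graft P w : wf P -> expands (leaves P) w ->
  exists P', [/\ wf P', root P' = root P & leaves P' = w].
Proof.
elim: P w => [e w _ /expands1 //|t l IHl r IHr w /= [tl tr wl wr]].
move/expands_catl=> [u [v [-> /(IHl _ wl) [l' [wl' rl' <-]]]]].
move=> /(IHr _ wr) [r' [wr' rr' <-]].
by exists (Node t l' r'); rewrite /= rl' rr'.
Qed.

Lemma expands_trans u v w : expands u v -> expands v w -> expands u w.
Proof.
move=> uv; elim: uv w => // P v1 v2 wfP _ IH w.
move=> /expands_catl [w1 [w2 [-> /(graft wfP) [P' [wfP' <- <-]] /IH vw]]].
exact: expands_cons.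
Qed.

Lemma expands_unit_l (d u : X 1) :
  u = edge ord0 ord0 (source d) -> expands [:: d] [:: u; d].
Proof.
move=> ->; have := expands_triangle (restr (tmap ord0 ord0 ord_max) d).
by rewrite !edge_tmap /tmap /= edge_id edge_vertex.
Qed.

Lemma expands_unit_r (d u : X 1) :
  u = edge ord0 ord0 (target d) -> expands [:: d] [:: d; u].
Proof.
move=> ->; have := expands_triangle (restr (tmap ord0 ord_max ord_max) d).
by rewrite !edge_tmap /tmap /= edge_id edge_vertex.
Qed.

(** The inverse of an edge e is an edge, so that a word starting at the source of
    e can be prolonged on the left by e e^-1; the degenerate edge at the source
    is the intermediate step. *)
Lemma expands_flip n (i j : 'I_n.+1) (x : X n) (d : X 1) :
  source d = vertex i x -> expands [:: d] [:: edge i j x; edge j i x; d].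
Proof.
move=> dx; apply: expands_trans (expands_unit_l erefl) _.
rewrite dx edge_vertex; have := expands_triangle (restr (tmap i j i) x).
rewrite !edge_tmap /tmap /= => /expands_cat/(_ (expands_refl [:: d])); exact.
Qed.

(** By induction on the second pasting. If it is a node with subtrees l and r,
    then precomposing P with the inverse of the root of l gives a pasting with
    the same root as r; a common expansion w of its leaves and of the leaves of
    r, prolonged by the leaves of l, is a common expansion of the leaves of P
    and of l ++ r. *)
Lemma pasting_confluence P Q : wf P -> wf Q -> root P = root Q ->
  exists w, expands (leaves P) w /\ expands (leaves Q) w.
Proof.
elim: Q P => [e P wfP _ /= rP|t l _ r IHr P wfP /= [tl tr wl wr] rP].
  exists (leaves P); split; first exact: expands_refl.
  by rewrite -rP; exact: expands_root.
pose P' := Node (restr (tmap mid ord0 ord_max) t) (Leaf (edge mid ord0 t)) P.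
have [||w [P'w rw]] := IHr P' _ wr; first by rewrite /= !edge_tmap.
  by rewrite /= edge_tmap.
exists (leaves l ++ w); split; last exact: expands_cat (expands_refl _) rw.
have := walk_leaves wfP; move: P'w; rewrite /=.
case: (leaves P) (size_leaves_gt0 P) => //= d u _ P'w [ds _].
apply: expands_trans (expands_cat (expands_flip mid _) (expands_refl u)) _.
  by rewrite ds rP source_edge.
by rewrite tl; apply: (expands_cat (expands_root wl)).
Qed.

Lemma expands_confluence u v w : expands u v -> expands u w ->
  exists2 z, expands v z & expands w z.
Proof.
move=> uv; elim: uv w => [w /expands_inv ->|P u1 v1 wfP _ IH w].
  by exists [::]; exact: expands_nil.
move=> /expands_inv [Q [w1 [wfQ rQ /IH [z vz wz] ->]]].
have [y [Py Qy]] := pasting_confluence wfP wfQ (esym rQ).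
by exists (y ++ z); apply: expands_cat.
Qed.

Definition joinable (u v : seq (X 1)) : Prop :=
  exists2 w, expands u w & expands v w.

Lemma joinable_sym u v : joinable u v -> joinable v u.
Proof. by case=> w uw vw; exists w. Qed.

Lemma joinable_expands u v : expands u v -> joinable u v.
Proof. by exists v => //; apply: expands_refl. Qed.

Lemma joinable_trans u v w : joinable u v -> joinable v w -> joinable u w.
Proof.
case=> x ux vx [y vy wy]; have [z xz yz] := expands_confluence vx vy.
by exists z; [exact: expands_trans xz | exact: expands_trans yz].
Qed.

Fixpoint word_of (z x : X 0) (p : epath z x) : seq (X 1) :=
  match p with pnil => [::] | pcons _ _ e p' => sval e :: word_of p' end.

Lemma word_of_cat x y z (p : epath y x) (q : epath z y) :
  word_of (pcat q p) = word_of p ++ word_of q.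
Proof. by elim: p q => //= u v e p IH q; rewrite IH. Qed.

(** The case analysis of a path whose two end points may coincide, where
    dependent elimination is not available. *)
Lemma epath_inv z x (p : epath z x) :
  match word_of p with
  | [::] => exists E : z = x, p = match E with erefl => pnil z end
  | d :: w => exists y (e : edge_between x y) (q : epath z y),
      [/\ sval e = d, word_of q = w & p = pcons e q]
  end.
Proof. by case: p => [|u y e p] /=; [exists erefl | exists y, e, p]. Qed.

Lemma word_of_inj z x (p q : epath z x) : word_of p = word_of q -> p = q.
Proof.
elim: p q => [|{}x y e p IH] q /= pq; have := epath_inv q; rewrite -pq.
  by case=> E ->; rewrite (Prop_irrelevance E erefl).
case=> y' [e' [q' [ee qq ->]]].
have yy : y' = y by rewrite -(proj2 (svalP e')) ee (proj2 (svalP e)).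
case: _ / yy e p IH ee qq {pq} => e p IH ee qq.
rewrite (IH q' (esym qq)); congr pcons.
by case: e e' ee => [d dx] [d' dx'] /= dd; apply: eq_exist.
Qed.

(** The extra edge [a] in front makes sure that the words are not empty: a
    degenerate edge can then be created by expanding the edge before it,
    whereas the empty word has no expansion but itself. *)
Lemma joinable_step z x (p q : epath z x) (a : X 1) :
  target a = x -> epath_step p q -> joinable (a :: word_of p) (a :: word_of q).
Proof.
move=> ax st; elim: st a ax => /=
  [u v w e f g t p' te tf tg|u e p' ue|u v e p' q' _ IH] a au.
- apply/joinable_sym/joinable_expands/expands_leaf; rewrite -te -tf -tg.
  exact: (expands_cat (expands_triangle t) (expands_refl _)).
- apply/joinable_sym/joinable_expands.
  apply: (@expands_cat [:: a] [:: a; sval e]); last exact: expands_refl.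
  by apply: expands_unit_r; rewrite au.
- have [w pw qw] := IH _ (proj2 (svalP e)).
  by exists (a :: w); apply: expands_leaf.
Qed.

(** Confluence makes joinability transitive, so a zigzag of elementary moves
    between the two edges gives a common expansion; a degenerate edge serves as
    the edge in front of both. *)
Lemma joinable_of_tau x y (e f : edge_between x y) :
  tau_edge e = tau_edge f -> joinable [:: sval e] [:: sval f].
Proof.
move/cls_eqP => ef; pose a := edge ord0 ord0 x.
have ax : target a = x by rewrite target_edge vertex_id.
have join p q : clos_refl_sym_trans _ (@epath_step X y x) p q ->
    joinable (a :: word_of p) (a :: word_of q).
  elim=> [u v|u|u v _|u v w _ uv _]; first exact: joinable_step.
  - exact/joinable_expands/expands_refl.
  - exact: joinable_sym.
  - exact: joinable_trans.
have unit (g : edge_between x y) : joinable [:: sval g] [:: a; sval g].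
  by apply/joinable_expands/expands_unit_l; rewrite (proj1 (svalP g)).
apply: joinable_trans (unit e) (joinable_trans (join _ _ ef) _).
exact/joinable_sym/unit.
Qed.

End Pasting.

(** * Equality of edges in the groupoid tau X *)

Section Tau.
Variable X : symset.
Implicit Types P Q : pasting X.

(** The root of a pasting is the product of its leaves: one triangle relation
    for each node. *)
Lemma tau_edge_pasting P : wf P ->
  forall x y (e : edge_between x y), sval e = root P ->
  exists2 p : epath y x, word_of p = leaves P &
    tau_edge e = cls (@epath_step X y x) p.
Proof.
elim: P => [d _|t l IHl r IHr /= [tl tr wl wr]] x y e /= eP.
  by exists (pcons e (pnil y)) => //=; rewrite eP.
have xt : source (edge ord0 mid t) = x /\
          target (edge ord0 mid t) = vertex mid t.
  by rewrite source_edge target_edge -(proj1 (svalP e)) eP source_edge.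
have ty : source (edge mid ord_max t) = vertex mid t /\
          target (edge mid ord_max t) = y.
  by rewrite source_edge target_edge -(proj2 (svalP e)) eP target_edge.
have [p pl ep] := IHl wl _ _ (exist _ _ xt : edge_between _ _) tl.
have [q qr eq] := IHr wr _ _ (exist _ _ ty : edge_between _ _) tr.
exists (pcat q p); first by rewrite word_of_cat pl qr.
rewrite -tau_comp_cls -ep -eq tau_comp_cls.
by apply/esym/cls_eq; apply: step_triangle (esym eP).
Qed.

Lemma tau_edge_eqP x y (e f : edge_between x y) :
  tau_edge e = tau_edge f <->
  exists P Q, [/\ wf P, wf Q, leaves P = leaves Q, root P = sval e &
    root Q = sval f].
Proof.
split=> [/joinable_of_tau [w]|[P [Q [wfP wfQ PQ eP fQ]]]].
  by move=> /expands1 [P [wfP <- <-]] /expands1 [Q [wfQ <- PQ]]; exists P, Q.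
have [p pP ->] := tau_edge_pasting wfP (esym eP).
have [q qQ ->] := tau_edge_pasting wfQ (esym fQ).
by rewrite (@word_of_inj _ _ _ p q) // pP qQ.
Qed.

End Tau.

(** * Chords of a pasting *)

Section Chords.
Variable X : symset.
Implicit Types P Q : pasting X.

(** Reading the leaves of P as the sides (o, o+1), (o+1, o+2), ... of a polygon,
    every subtree spans a chord; these are the sides and diagonals of the
    triangulation that P describes. *)
Fixpoint chord P (o a b : nat) : bool :=
  (a == o) && (b == o + size (leaves P)) ||
  match P with
  | Leaf _ => false
  | Node _ l r => chord l o a b || chord r (o + size (leaves l)) a b
  end.

(** The value is meaningful on the chords of P only. *)
Fixpoint label P (o a b : nat) : X 1 :=
  if (a == o) && (b == o + size (leaves P)) then root P else
  match P with
  | Leaf e => e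
  | Node _ l r =>
    if b <= o + size (leaves l) then label l o a b
    else label r (o + size (leaves l)) a b
  end.

Lemma chord_root P o : chord P o o (o + size (leaves P)).
Proof. by case: P => * /=; rewrite !eqxx. Qed.

Lemma label_root P o : label P o o (o + size (leaves P)) = root P.
Proof. by case: P => * /=; rewrite !eqxx. Qed.

Lemma chord_node t l r o a b :
  chord (Node t l r) o a b ->
  [\/ a = o /\ b = o + (size (leaves l) + size (leaves r)), chord l o a b |
      chord r (o + size (leaves l)) a b].
Proof.
by rewrite /= size_cat => /orP[/andP[/eqP-> /eqP->]|/orP[]]; constructor.
Qed.

Lemma chord_range P o a b : chord P o a b ->
  [&& o <= a, a < b & b <= o + size (leaves P)].
Proof.
elim: P o a b => [e|t l IHl r IHr] o a b; first by rewrite /=; lia.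
have := size_leaves_gt0 l; have := size_leaves_gt0 r.
move=> r0 l0 /chord_node[[-> ->]|/IHl|/IHr]; rewrite /= size_cat; lia.
Qed.

Lemma chord_l t l r o a b : chord l o a b -> chord (Node t l r) o a b.
Proof. by move=> /= ->; rewrite orbT. Qed.

Lemma chord_r t l r o a b :
  chord r (o + size (leaves l)) a b -> chord (Node t l r) o a b.
Proof. by move=> /= ->; rewrite !orbT. Qed.

Lemma label_l t l r o a b :
  chord l o a b -> label (Node t l r) o a b = label l o a b.
Proof.
move=> /chord_range lab /=; have r0 := size_leaves_gt0 r.
rewrite size_cat; case: ifP => [|_]; first by lia.
by case: ifP => //; lia.
Qed.

Lemma label_r t l r o a b : chord r (o + size (leaves l)) a b ->
  label (Node t l r) o a b = label r (o + size (leaves l)) a b.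
Proof.
move=> /chord_range rab /=; have l0 := size_leaves_gt0 l.
rewrite size_cat; case: ifP => [|_]; first by lia.
by case: ifP => //; lia.
Qed.

Lemma chord_noncrossing P o a b c d :
  chord P o a b -> chord P o c d -> ~~ [&& a < c, c < b & b < d].
Proof.
elim: P o => [e|t l IHl r IHr] o; first by rewrite /=; lia.
case/chord_node=> [[-> ->]|ab|ab].
- by move=> /chord_range /=; rewrite size_cat; lia.
- case/chord_node=> [[-> ->]|/(IHl o ab)//|/chord_range];
  have := chord_range ab; lia.
- case/chord_node=> [[-> ->]|/chord_range|/(IHr _ ab)//];
  have := chord_range ab; lia.
Qed.

(** If a chord is contained in neither half of the polygon cut at the apex of
    the root, it crosses one of the two chords below the root unless it is the
    long edge. *)
Lemma chord_maximal P o a b : o <= a -> a < b -> b <= o + size (leaves P) ->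
  (forall c d, chord P o c d ->
     ~~ [&& a < c, c < b & b < d] && ~~ [&& c < a, a < d & d < b]) ->
  chord P o a b.
Proof.
elim: P o => [e|t l IHl r IHr] o oa ab; first by rewrite /=; lia.
rewrite /= size_cat => bn ncr; set m := o + size (leaves l) in ncr *.
case: (leqP b m) => bm.
  rewrite IHl ?orbT //= => c d cd; apply: ncr; by rewrite cd orbT.
case: (leqP m a) => ma.
  rewrite IHr ?orbT // ?/m; try lia.
  by move=> c d cd; apply: ncr; rewrite cd !orbT.
have := ncr o m; have := ncr m (m + size (leaves r)).
rewrite !chord_root !orbT => /(_ isT) H1 /(_ isT) H2.
by apply/orP; left; move: H1 H2; rewrite /m; lia.
Qed.

Lemma chord_leaf P o k : k < size (leaves P) -> chord P o (o + k) (o + k).+1.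
Proof.
elim: P o k => [e|t l IHl r IHr] o k; first by rewrite /=; lia.
rewrite /= size_cat => kn; case: (ltnP k (size (leaves l))) => kl.
  by rewrite IHl ?orbT.
have := IHr (o + size (leaves l)) (k - size (leaves l)).
by rewrite -addnA subnKC // => ->; rewrite ?orbT //; lia.
Qed.

Lemma label_leaf e0 P o k : k < size (leaves P) ->
  label P o (o + k) (o + k).+1 = nth e0 (leaves P) k.
Proof.
elim: P o k => [e|t l IHl r IHr] o k.
  by case: k => // _; rewrite /= addn0 eqxx addn1 eqxx.
rewrite [size _]/= size_cat => kn; rewrite [in RHS]/= nth_cat.
case: ltnP => kl; first by rewrite label_l ?IHl ?chord_leaf.
have kr : k - size (leaves l) < size (leaves r) by lia.
have := chord_leaf (o + size (leaves l)) kr; have := IHr (o + size (leaves l)) _ kr.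
by rewrite -addnA subnKC // => <- ch; rewrite label_r.
Qed.

Lemma label_vertex (v : nat -> X 0) P o : wf P ->
  (forall e0 k, k < size (leaves P) -> source (nth e0 (leaves P) k) = v (o + k) /\
     target (nth e0 (leaves P) k) = v (o + k).+1) ->
  forall a b, chord P o a b ->
  source (label P o a b) = v a /\ target (label P o a b) = v b.
Proof.
move=> wfP; elim: P o wfP => [e|t l IHl r IHr] o wfP.
  move=> ve a b /=; rewrite orbF => /[dup] /andP[/eqP-> /eqP->] ->.
  by have := ve e 0 isT; rewrite /= addn0 addn1.
case: wfP => tl tr wl wr ve.
have {}IHl := IHl o wl; have {}IHr := IHr (o + size (leaves l)) wr.
have Hl a b : chord l o a b ->
  source (label l o a b) = v a /\ target (label l o a b) = v b.
  apply: IHl => e0 k kl; have := ve e0 k; rewrite nth_cat kl; apply.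
  by rewrite /= size_cat; lia.
have Hr a b : chord r (o + size (leaves l)) a b ->
   source (label r (o + size (leaves l)) a b) = v a /\
   target (label r (o + size (leaves l)) a b) = v b.
  apply: IHr => e0 k kr; have := ve e0 (size (leaves l) + k).
  rewrite nth_cat (_ : _ < size (leaves l) = false) ?addKn ?addnA; last by lia.
  by apply; rewrite /= size_cat; lia.
move=> a b /(@chord_node t) [[-> ->]|ab|ab].
- have [+ _] := Hl _ _ (chord_root l o).
  have [_ +] := Hr _ _ (chord_root r (o + size (leaves l))).
  rewrite !label_root -tl -tr source_edge target_edge -addnA => tv sv.
  by rewrite /= size_cat !eqxx /= source_edge target_edge.
- by have := @label_l t l r o a b ab => /= ->; apply: Hl.
- by have := @label_r t l r o a b ab => /= ->; apply: Hr.
Qed.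

(** Three pairwise joined vertices are the corners of a node: otherwise one of
    the three chords would cross a chord of the root. *)
Lemma label_triangle P o i j k : wf P ->
  chord P o i j -> chord P o j k -> chord P o i k ->
  exists t : X 2, [/\ edge ord0 mid t = label P o i j,
    edge mid ord_max t = label P o j k & edge ord0 ord_max t = label P o i k].
Proof.
elim: P o => [e|t l IHl r IHr] o; first by rewrite /=; lia.
move=> [tl tr wl wr] ij jk ik.
have l0 := size_leaves_gt0 l; have r0 := size_leaves_gt0 r.
have ij' := chord_range ij; have jk' := chord_range jk.
case: (chord_node ik) => [[io ke]|ik'|ik'].
- subst i k; set m := o + size (leaves l).
  have jm : j = m.
    have := chord_noncrossing ij (chord_r t (chord_root r m)).
    have := chord_noncrossing (chord_l t r (chord_root l o)) jk.
    by rewrite /m in jk' *; lia.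
  rewrite addnA -/m in jk ik *; subst j; exists t.
  rewrite label_l ?chord_root // label_r ?chord_root // !label_root.
  by rewrite {1}/label size_cat addnA !eqxx.
- have ikr := chord_range ik'.
  have ij2 : chord l o i j.
    by case: (chord_node ij) => [[? ?]|//|/chord_range]; lia.
  have jk2 : chord l o j k.
    by case: (chord_node jk) => [[? ?]|//|/chord_range]; lia.
  by rewrite !label_l //; apply: IHl.
- have ikr := chord_range ik'.
  have ij2 : chord r (o + size (leaves l)) i j.
    by case: (chord_node ij) => [[? ?]|/chord_range|//]; lia.
  have jk2 : chord r (o + size (leaves l)) j k.
    by case: (chord_node jk) => [[? ?]|/chord_range|//]; lia.
  by rewrite !label_r //; apply: IHr.
Qed.

(** A chord that spans two leaves is a node with two leaves; cutting it off
    leaves a pasting with the same root in which the two leaves are replaced by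
    their composite. *)
Lemma cherry_contraction P o a : wf P -> chord P o a a.+2 ->
  exists (t : X 2) u v Q,
   [/\ size u = a - o, leaves P = u ++ [:: edge ord0 mid t; edge mid ord_max t] ++ v,
       wf Q, root Q = root P & leaves Q = u ++ edge ord0 ord_max t :: v].
Proof.
elim: P o => [e|t l IHl r IHr] o; first by rewrite /=; lia.
move=> [tl tr wl wr] /chord_node[[-> sz]|/[dup] /chord_range ao|
  /[dup] /chord_range ao].
- have l0 := size_leaves_gt0 l; have r0 := size_leaves_gt0 r.
  have size1 P : size (leaves P) = 1 -> leaves P = [:: root P].
    case: P => //= t' l' r'; rewrite size_cat.
    by have := size_leaves_gt0 l'; have := size_leaves_gt0 r'; lia.
  exists t, [::], [::], (Leaf (edge ord0 ord_max t)).
  split=> //; first by rewrite subnn.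
  have ll : leaves l = [:: root l] by apply: size1; lia.
  have lr : leaves r = [:: root r] by apply: size1; lia.
  by rewrite [leaves _]/= ll lr tl tr.
- move/(IHl o wl)=> [t' [u [v [Q [su lu wQ rQ lQ]]]]].
  by exists t', u, (v ++ leaves r), (Node t Q r); rewrite /= lu lQ rQ -!catA.
- move/(IHr _ wr)=> [t' [u [v [Q [su ru wQ rQ lQ]]]]].
  exists t', (leaves l ++ u), v, (Node t l Q); rewrite /= ru lQ rQ -!catA; split=> //.
  by rewrite size_cat su; lia.
Qed.

End Chords.

(** * Maps from a triangulated polygon to a partial groupoid *)

Section Simplices.
Variable X : partial_groupoid.

Lemma principal_edge_inj n (x y : X n) : 0 < n ->
  (forall i, principal_edge x i = principal_edge y i) -> x = y.
Proof.
move=> n0 xy; apply: (pg_spiny n0); apply: eq_exist; exact: funext.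
Qed.

(** This form of spininess treats vertices like the other simplices: a vertex is
    recovered from the degenerate edge at it. *)
Lemma simplex_eq n (x y : X n) :
  (forall i j, edge i j x = edge i j y) -> x = y.
Proof.
case: n x y => [|n] x y xy; last by apply: principal_edge_inj => // i; apply: xy.
by rewrite -(vertex_id x ord0) -(vertex_id y ord0) -!(source_edge ord0 ord0) xy.
Qed.

Lemma triangle_eq (t t' : X 2) :
  edge ord0 mid t = edge ord0 mid t' ->
  edge mid ord_max t = edge mid ord_max t' -> t = t'.
Proof.
move=> t01 t12; apply: principal_edge_inj => // -[[|[|//]] lti];
  rewrite /principal_edge.
- have -> : widen_ord (leqnSn 2) (Ordinal lti) = ord0 by exact: val_inj.
  by have -> : lift ord0 (Ordinal lti) = mid by exact: val_inj.
- have -> : widen_ord (leqnSn 2) (Ordinal lti) = mid by exact: val_inj.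
  by have -> : lift ord0 (Ordinal lti) = ord_max by exact: val_inj.
Qed.

(** An edge of X for every pair of vertices is enough to define a map on a
    triangulated polygon, provided that each triangle of the polygon can be
    filled: by spininess a simplex is filled in at most one way, so no coherence
    between the triangles has to be checked. *)
Section Filling.
Variables (n : nat) (T : triangulation n) (E : 'I_n.+1 -> 'I_n.+1 -> X 1).
Hypothesis E_triangle : forall i j k, (i, j, k) \in triangles T ->
  exists t : X 2, forall a b, edge a b t = E (tmap i j k a) (tmap i j k b).

Lemma fill_ex m (s : tri_symset T m) :
  exists y : X m, forall k l, edge k l y = E (sval s k) (sval s l).
Proof.
case: s => s [[[a b] c] /E_triangle [t tE] /= sabc].
pose h q : 'I_3 := if s q == a then ord0 else if s q == c then ord_max else mid.
have hE q : tmap a b c (h q) = s q.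
  have := sabc q; rewrite !inE /h /tmap.
  case: (s q =P a) => [->|_] //=; case: (s q =P c) => [->|_] //=.
  by rewrite orbF => /eqP.
by exists (restr h t) => k l; rewrite edge_restr tE !hE.
Qed.

Definition fill m (s : tri_symset T m) : X m := sval (cid (fill_ex s)).

Lemma fillE m (s : tri_symset T m) k l :
  edge k l (fill s) = E (sval s k) (sval s l).
Proof. exact: (svalP (cid (fill_ex s))). Qed.

Lemma fill_restr l m (h : 'I_l.+1 -> 'I_m.+1) (s : tri_symset T m) :
  fill (restr h s) = restr h (fill s).
Proof. by apply: simplex_eq => i j; rewrite edge_restr !fillE. Qed.

Definition fill_map : symmap (tri_symset T) X := SymMap fill_restr.

End Filling.
End Simplices.

(** * Compatibility means having no common ear *)

Lemma tri_symset_eq n (T : triangulation n) m (b c : tri_symset T m) :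
  sval b = sval c -> b = c.
Proof. by case: b c => b Hb [c Hc] /= bc; apply: eq_exist. Qed.

Section Compatibility.
Variables (n : nat) (T T' : triangulation n).

(** Crossing the value v in steps of size at most 1 would mean taking it. *)
Lemma discrete_ivt m (u : nat -> nat) v :
  (forall p, p < m -> u p <= (u p.+1).+1 /\ u p.+1 <= (u p).+1) ->
  (forall p, p <= m -> u p <> v) ->
  forall p, p <= m -> (u p < v) = (u 0 < v).
Proof.
move=> step nv; elim=> // p IH pm; rewrite -IH; last by lia.
have := step p pm; have := nv p.+1 pm; have := nv p (ltnW pm); lia.
Qed.

(** Consecutive vertices of such a simplex differ by at most 1, so it takes all
    values between its minimum i and its maximum; either the maximum is at most
    i + 1, or i, i + 1 and i + 2 are among the values. *)
Lemma spine_or_ear m (s : representable n m) : 0 < n ->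
  (forall p q : 'I_m.+1, q = p.+1 :> nat -> s p <= (s q).+1 /\ s q <= (s p).+1) ->
  in_spine s \/
  exists2 i, i.+2 <= n & forall v, i <= v <= i.+2 -> exists q, s q = v :> nat.
Proof.
move=> n0 step.
have := @arg_minnP _ ord0 predT (fun k => s k : nat) isT.
case=> p _ minp.
have := @arg_maxnP _ ord0 predT (fun k => s k : nat) isT.
case=> q _ maxq.
have qn := ltn_ord (s q).
case: (leqP (s q) (s p).+1) => pq; [left|right].
  (* The last vertex n starts no side; a constant simplex at n is in the side
     that ends there. *)
  have lti : (if s p < n then s p : nat else n.-1) < n by case: ifP; lia.
  exists (Ordinal lti) => k /=.
  have := minp k isT; have := maxq k isT; case: ifP; lia.
exists (s p) => [|v pv]; first by rewrite /=; lia.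
apply: contrapT => nv.
pose u k := s (inord k) : nat.
have uE (k : 'I_m.+1) : u k = s k by rewrite /u inord_val.
have ivt := @discrete_ivt m u v.
have pm := ltn_ord p; have qm := ltn_ord q.
have ivt' k : k <= m -> (u k < v) = (u 0 < v).
  apply: ivt => [j jm|j jm uj]; last by apply: nv; exists (inord j).
  by apply: step; rewrite !inordK; lia.
have Hp := ivt' p; have Hq := ivt' q; rewrite !uE in Hp Hq.
have np : s p <> v :> nat by move=> e; apply: nv; exists p.
lia.
Qed.

Lemma ear_tri_edge (U : triangulation n) m (s : representable n m) (i j : 'I_n.+1) :
  j = i.+2 :> nat -> in_triangles U s ->
  (forall v, i <= v <= i.+2 -> exists q, s q = v :> nat) -> tri_edge U i j.
Proof.
move=> ji [[[a b] c]]; rewrite inE /= => /and5P[ab bc _ _ ac] sabc sv.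
have mem v : i <= v <= i.+2 -> v = a \/ v = b \/ v = c.
  move=> /sv [q <-]; have := sabc q; rewrite !inE.
  by case/or3P=> /eqP->; auto.
have m0 := mem i; have m1 := mem i.+1; have m2 := mem i.+2.
have -> : i = a by apply: val_inj => /=; lia.
by have -> : j = c by apply: val_inj => /=; lia.
Qed.

(** The simplex of the standard simplex below a simplex of either half; it is
    constant along the gluing. *)
Definition under m (x : tri_symset T m + tri_symset T' m) : representable n m :=
  match x with inl b => sval b | inr c => sval c end.

Local Notation glueT := (@glue _ _ _ (spine_incl T) (spine_incl T')).

Lemma under_cls m x y : cls (@glueT m) x = cls (@glueT m) y -> under x = under y.
Proof. by move/cls_eqP; apply: clos_invariant => _ _ [a]. Qed.

(** The predicate that holds on the first half and means lying in the spine on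
    the second half is constant along the gluing. *)
Lemma glued_in_spine m (b : tri_symset T m) (c : tri_symset T' m) :
  cls (@glueT m) (inl b) = cls (@glueT m) (inr c) <->
  in_spine (sval b) /\ sval b = sval c.
Proof.
split=> [bc|[bs bc]].
  split; last exact: (under_cls bc).
  pose k (x : tri_symset T m + tri_symset T' m) : Prop :=
    if x is inr c then in_spine (sval c) else True.
  have : k (inl b) = k (inr c).
    move/cls_eqP: bc; apply: clos_invariant => _ _ [a] /=.
    by apply/esym/propT/(svalP a).
  by have /= -> := under_cls bc => <-.
pose a : spine n m := exist _ _ bs.
have -> : b = spine_incl T m a by exact: tri_symset_eq.
have -> : c = spine_incl T' m a by apply: tri_symset_eq; rewrite -bc.
exact/cls_eq/glue_intro.
Qed.

Definition no_common_ear : Prop := forall i j : 'I_n.+1,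
  j = i.+2 :> nat -> tri_edge T i j -> tri_edge T' i j -> False.

(** A simplex is determined by its half and by the function under it, hence two
    simplices with the same principal edges can only differ by lying in
    different halves. Their principal edges then lie in the spine, and
    [spine_or_ear] either puts the simplices themselves in the spine or
    produces an ear, which belongs to both triangulations. *)
Lemma no_common_ear_compatible : no_common_ear -> compatible T T'.
Proof.
move=> noear m m0 x y /(congr1 sval)/= xy.
have {}xy i : principal_edge x i = principal_edge y i by rewrite xy.
elim/quotE: x xy => x; elim/quotE: y => y xy.
have edgeE (z : tri_symset T m + tri_symset T' m) (i : 'I_m) :
    principal_edge (cls (@glueT m) z : glued_triangulations T T' m) i =
    cls (@glueT 1) (sum_restr (emap (widen_ord (leqnSn m) i) (lift ord0 i)) z).
  exact: pushout_restr_cls.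
have {}xy i := etrans (esym (edgeE x i)) (etrans (xy i) (edgeE y i)).
have uxy : under x = under y.
  apply: funext => k.
  have uE z i : under (sum_restr (emap (widen_ord (leqnSn m) i) (lift ord0 i)) z) =
     under z \o emap (widen_ord (leqnSn m) i) (lift ord0 i) by case: z.
  have ue i := under_cls (xy i).
  have {}ue i := etrans (esym (uE x i)) (etrans (ue i) (uE y i)).
  case: (ltnP k m) => km.
    have /(congr1 (fun f => f ord0)) := ue (Ordinal km).
    rewrite /= /emap /=; have -> // : widen_ord (leqnSn m) (Ordinal km) = k.
    exact: val_inj.
  have km1 : k.-1 < m by have := ltn_ord k; lia.
  have /(congr1 (fun f => f ord_max)) := ue (Ordinal km1).
  rewrite /= /emap /=; have -> // : lift ord0 (Ordinal km1) = k.
  by apply: val_inj; rewrite /= /bump /=; lia.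
have mixed (b : tri_symset T m) (c : tri_symset T' m) : sval b = sval c ->
    (forall i : 'I_m,
      in_spine (sval b \o emap (widen_ord (leqnSn m) i) (lift ord0 i))) ->
    cls (@glueT m) (inl b) = cls (@glueT m) (inr c).
  move=> bc bs; apply/glued_in_spine; split=> //.
  have n0 : 0 < n by have := polygon_size T; lia.
  have [p q qp|//|[i i2 iv]] := @spine_or_ear m (sval b) n0.
    have pm : p < m by have := ltn_ord q; lia.
    have [d dE] := bs (Ordinal pm).
    have := dE ord0; have := dE ord_max; rewrite /= /emap /=.
    have -> : widen_ord (leqnSn m) (Ordinal pm) = p by exact: val_inj.
    have -> : lift ord0 (Ordinal pm) = q by apply: val_inj; rewrite /= /bump /=; lia.
    lia.
  have iE : (inord i : 'I_n.+1) = i :> nat by rewrite inordK //; lia.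
  have jE : (inord i.+2 : 'I_n.+1) = i.+2 :> nat by rewrite inordK //; lia.
  exfalso; apply: (noear (inord i) (inord i.+2)); first by rewrite iE.
    apply: (ear_tri_edge _ (svalP b)); rewrite iE //.
  by apply: (ear_tri_edge _ (svalP c)); rewrite iE // -bc.
case: x y uxy xy {edgeE} => [b|b] [c|c] /= bc xy.
- by congr (cls _ (inl _)); apply: tri_symset_eq.
- apply: mixed => // i.
  by have /glued_in_spine[] := xy i.
- apply/esym/mixed => // i.
  by have /esym/glued_in_spine[] := xy i.
- by congr (cls _ (inr _)); apply: tri_symset_eq.
Qed.

End Compatibility.

(** * The triangulation and the map described by a pasting *)

Section PastingTriangulation.
Variables (X : symset) (P : pasting X) (n : nat).
Hypotheses (n2 : 2 <= n) (sizeP : size (leaves P) = n).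

Definition pasting_diags : {set 'I_n.+1 * 'I_n.+1} :=
  [set d | diagonal d && chord P 0 d.1 d.2].

Lemma pasting_diags_diagonal d : d \in pasting_diags -> diagonal d.
Proof. by rewrite inE => /andP[]. Qed.

Lemma pasting_diags_noncrossing d e :
  d \in pasting_diags -> e \in pasting_diags -> ~~ crossing d e.
Proof.
case: d e => [a b] [c d]; rewrite !inE => /andP[_ /= dP] /andP[_ /= eP].
rewrite /crossing /=.
have := chord_noncrossing dP eP; have := chord_noncrossing eP dP; lia.
Qed.

Lemma chord_side (a b : 'I_n.+1) : a < b -> side a b -> chord P 0 a b.
Proof.
move=> ab /orP[/eqP ba|/andP[/eqP-> /eqP->]].
  by rewrite ba; apply: chord_leaf; rewrite sizeP -ltnS -ba.
by have := chord_root P 0; rewrite sizeP.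
Qed.

Lemma pasting_diags_maximal d : diagonal d ->
  (forall e, e \in pasting_diags -> ~~ crossing d e) -> d \in pasting_diags.
Proof.
case: d => a b dd ncr; rewrite inE dd /=; have /andP[/= ab nside] := dd.
have bn := ltn_ord b.
apply: chord_maximal; rewrite ?sizeP // => c d cd.
have := chord_range cd; rewrite add0n sizeP => cdr.
case: (boolP (@side n (inord c) (inord d))) => [|nside'].
  by rewrite /side !inordK; lia.
have := ncr (inord c, inord d).
by rewrite inE /diagonal nside' /crossing /= !inordK ?cd; lia.
Qed.

Definition pasting_triangulation : triangulation n :=
  Triangulation n2 pasting_diags_diagonal pasting_diags_noncrossing
    pasting_diags_maximal.

Lemma pasting_tri_edge (a b : 'I_n.+1) :
  a < b -> tri_edge pasting_triangulation a b = chord P 0 a b.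
Proof.
move=> ab; rewrite /tri_edge inE /diagonal /= ab /=.
by case: (boolP (side a b)) => //= /(chord_side ab).
Qed.

End PastingTriangulation.

Lemma word_vertices (X : symset) x (w : seq (X 1)) y : walk x w y ->
  exists2 v : nat -> X 0, v 0 = x &
  forall e0 k, k < size w ->
    source (nth e0 w k) = v k /\ target (nth e0 w k) = v k.+1.
Proof.
elim: w x => [|e w IH] x /=; first by exists (fun=> x).
move=> [ex /IH [v v0 vw]].
exists (fun k => if k is k'.+1 then v k' else x) => // e0 [|k] /= kw.
  by rewrite v0.
exact: vw.
Qed.

Section Labelling.
Variables (X : partial_groupoid) (P : pasting X) (n : nat) (v : nat -> X 0).
Hypotheses (n2 : 2 <= n) (sizeP : size (leaves P) = n) (wfP : wf P).
Hypothesis vP : forall e0 k, k < size (leaves P) ->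
  source (nth e0 (leaves P) k) = v k /\ target (nth e0 (leaves P) k) = v k.+1.

(** The labels of the chords, extended by flips and degenerate edges as any map
    of symmetric sets must be. *)
Definition labelling (i j : 'I_n.+1) : X 1 :=
  if i < j then label P 0 i j
  else if j < i then edge ord_max ord0 (label P 0 j i)
  else edge ord0 ord0 (v i).

Let T := pasting_triangulation n2 sizeP.

Lemma labelling_triangle i j k : (i, j, k) \in triangles T ->
  exists t : X 2, forall a b,
    edge a b t = labelling (tmap i j k a) (tmap i j k b).
Proof.
rewrite inE /= => /and5P[ij jk].
have ik : i < k := ltn_trans ij jk.
rewrite !pasting_tri_edge // => cij cjk cik.
have [t [t01 t12 t02]] := label_triangle wfP cij cjk cik.
have vlab a b : chord P 0 a b ->
  source (label P 0 a b) = v a /\ target (label P 0 a b) = v b.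
  exact: label_vertex.
exists t.
have vt0 : vertex ord0 t = v i.
  by rewrite -(source_edge _ ord_max) t02; case: (vlab _ _ cik).
have vt2 : vertex ord_max t = v k.
  by rewrite -(target_edge ord0) t02; case: (vlab _ _ cik).
have vt1 : vertex mid t = v j.
  by rewrite -(target_edge ord0) t01; case: (vlab _ _ cij).
have ord3 (a : 'I_3) : [\/ a = ord0, a = mid | a = ord_max].
  by case: a => [[|[|[|//]]] lta]; [apply: Or31|apply: Or32|apply: Or33];
    apply: val_inj.
have tE0 : tmap i j k ord0 = i by [].
have tE1 : tmap i j k mid = j by [].
have tE2 : tmap i j k ord_max = k by [].
have deg (a : 'I_3) (l : 'I_n.+1) :
    vertex a t = v l -> edge a a t = labelling l l.
  by move=> vt; rewrite /labelling ltnn -vt edge_vertex.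
have flip (a b : 'I_3) : edge b a t = edge ord_max ord0 (edge a b t).
  by rewrite edge_edge.
move=> a b; have [->|->|->] := ord3 a; have [->|->|->] := ord3 b;
  rewrite ?tE0 ?tE1 ?tE2; try exact: deg.
- by rewrite /labelling ij.
- by rewrite /labelling ik.
- by rewrite /labelling ij ltnNge (ltnW ij) /= flip t01.
- by rewrite /labelling jk.
- by rewrite /labelling ik ltnNge (ltnW ik) /= flip t02.
- by rewrite /labelling jk ltnNge (ltnW jk) /= flip t12.
Qed.

Definition pasting_map : symmap (tri_symset T) X := fill_map labelling_triangle.

Lemma pasting_map_edge m (s : tri_symset T m) k l :
  edge k l (pasting_map m s) = labelling (sval s k) (sval s l).
Proof. exact: fillE. Qed.

Lemma pasting_map_long : pasting_map 1 (long_edge T) = root P.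
Proof.
rewrite -[LHS]edge_id pasting_map_edge /labelling /= /emap /=.
by have := label_root P 0; rewrite sizeP; case: ifP => //; lia.
Qed.

End Labelling.

Lemma labelling_spine (X : partial_groupoid) (P Q : pasting X) n v
    m (s : representable n m) k l :
  size (leaves P) = n -> leaves P = leaves Q -> in_spine s ->
  @labelling X P n v (s k) (s l) = @labelling X Q n v (s k) (s l).
Proof.
move=> sP PQ [i si]; rewrite /labelling.
have iP : i < size (leaves P) by rewrite sP.
have lab : label P 0 i i.+1 = label Q 0 i i.+1.
  rewrite -[i : nat]add0n (label_leaf (root P)) //.
  by rewrite (label_leaf (root P)) -?PQ.
by case: (si k) => ->; case: (si l) => ->;
  rewrite ?ltnn ?ltnSn ?lab // ltnNge leqnSn.
Qed.

(** * Pastings with the same leaves in a partial groupoid *)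

Section SameLeaves.
Variable X : partial_groupoid.
Hypothesis long_edges_identified :
  forall (n : nat) (T T' : triangulation n) (c : compatible T T')
    (f : symmap (NA c) X), f 1 (long_edge_l T T') = f 1 (long_edge_r T T').

Lemma cat_inj (A : Type) (u u' w w' : seq A) :
  size u = size u' -> u ++ w = u' ++ w' -> u = u' /\ w = w'.
Proof.
by elim: u u' => [|a u IH] [|a' u'] //= [/IH {}IH] [-> /IH [-> ->]].
Qed.

(** On the spine both maps are given by the leaves, so they glue to a map on the
    pushout of the two triangulations. *)
Lemma root_eq_of_no_common_cherry (P Q : pasting X) :
  wf P -> wf Q -> leaves P = leaves Q -> 1 < size (leaves P) ->
  (forall a, chord P 0 a a.+2 -> chord Q 0 a a.+2 -> False) ->
  root P = root Q.
Proof.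
move=> wfP wfQ PQ n2 noear; have sQ := esym (congr1 size PQ).
have [v _ vP] := word_vertices (walk_leaves wfP).
have vQ := vP; rewrite PQ in vQ.
have c : compatible (pasting_triangulation n2 erefl) (pasting_triangulation n2 sQ).
  apply: no_common_ear_compatible => i j ji.
  by rewrite !pasting_tri_edge ?ji; [exact: noear|lia..].
pose fP := pasting_map n2 erefl wfP vP.
pose fQ := pasting_map n2 sQ wfQ vQ.
have agree : symcomp fP (spine_incl _) = symcomp fQ (spine_incl _).
  apply: symmap_eq => m s /=; apply: simplex_eq => k l.
  rewrite !pasting_map_edge; apply: labelling_spine => //; exact: (svalP s).
have [w [[wl wr] _]] := pushout_universal agree.
have := @long_edges_identified _ _ _ c w.
rewrite -[w 1 _]/(symcomp w (pushout_inl _ _) 1 _) wl.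
rewrite -[w 1 _]/(symcomp w (pushout_inr _ _) 1 _) wr.
by rewrite !pasting_map_long.
Qed.

(** By induction on the number of leaves; common ears are cut off until
    [root_eq_of_no_common_cherry] applies or a single edge is left. *)
Lemma root_same_leaves (P Q : pasting X) :
  wf P -> wf Q -> leaves P = leaves Q -> root P = root Q.
Proof.
move: {2}(size (leaves P)).+1 (ltnSn (size (leaves P))) => N.
elim: N P Q => // N IH P Q PN wfP wfQ PQ.
case: (ltnP 1 (size (leaves P))) => [n2|n1]; last first.
  case: P PQ n1 {wfP PN} => [e|t l r] PQ n1; last first.
    have := size_leaves_gt0 l; have := size_leaves_gt0 r.
    by move: n1; rewrite /= size_cat; lia.
  case: Q PQ {wfQ} => [e' [->]//|t l r] PQ.
  have := size_leaves_gt0 l; have := size_leaves_gt0 r.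
  by have := congr1 size PQ; rewrite /= size_cat; lia.
have [[a [aP aQ]]|noear] := pselect (exists a, chord P 0 a a.+2 /\ chord Q 0 a a.+2);
  last by apply: root_eq_of_no_common_cherry => // a aP aQ; apply: noear; exists a.
have [t [u [w [P' [su lP wfP' <- lP']]]]] := cherry_contraction wfP aP.
have [t' [u' [w' [Q' [su' lQ wfQ' <- lQ']]]]] := cherry_contraction wfQ aQ.
have [uu] := cat_inj (etrans su (esym su'))
  (etrans (esym lP) (etrans PQ lQ)).
move=> /= [t01 t12 ww].
apply: IH => //; last by rewrite lP' lQ' uu ww (triangle_eq t01 t12).
by move: PN; rewrite lP lP' !size_cat /=; lia.
Qed.

End SameLeaves.

(** * The pasting of a triangulated polygon *)

Section Boundary.
Variables (n : nat) (T : triangulation n) (X : symset).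
Variables (f : symmap (tri_symset T) X) (s : nat -> X 1).
Hypothesis spine_s : forall (i j : 'I_n.+1) (y : tri_symset T 1),
  j = i.+1 :> nat -> sval y = emap i j -> f 1 y = s i.

(** The farthest vertex before [b] that is joined to [a]: a diagonal separating
    it from [b] would have to start at [a] and end farther. *)
Lemma apex (a b : 'I_n.+1) : a.+1 < b -> tri_edge T a b ->
  exists2 j : 'I_n.+1, a < j < b & tri_edge T a j /\ tri_edge T j b.
Proof.
move=> ab eab; have bn := ltn_ord b.
pose A (k : 'I_n.+1) := (a < k < b) && tri_edge T a k.
have A1 : A (inord a.+1).
  by rewrite /A /tri_edge /side inordK; [rewrite ltnSn ab eqxx|lia].
case: (@arg_maxnP _ (inord a.+1) A val A1) => k /andP[/andP[ak kb] eak] kmax.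
exists k; first by rewrite ak kb.
split=> //; apply: tri_edge_maximal => // c d cd ecd; apply/negP => cr.
have := tri_edge_noncrossing ak cd eak ecd.
have := tri_edge_noncrossing (ltn_trans ak kb) cd eab ecd.
have := kmax d; rewrite /A; move: cr; rewrite /crossing /=.
case: (eqVneq c a) => [ca|/eqP ca].
  by rewrite -ca ecd; have := congr1 val ca; rewrite /=; lia.
have {}ca : c <> a :> nat by move/val_inj.
lia.
Qed.

(** By induction, cutting the polygon spanned by [a] and [b] at the apex. *)
Lemma triangulation_pasting (a b : 'I_n.+1) (y : tri_symset T 1) :
  a < b -> tri_edge T a b -> sval y = emap a b ->
  exists P : pasting X,
    [/\ wf P, root P = f 1 y & leaves P = [seq s i | i <- iota a (b - a)]].
Proof.
move: {2}(b - a).+1 (ltnSn (b - a)) => N.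
elim: N a b y => // N IH a b y abN ab eab yab.
case: (ltnP a.+1 b) => ab1; last first.
  have ba : b = a.+1 :> nat by lia.
  by exists (Leaf (f 1 y)); rewrite (spine_s ba yab) ba subSnn.
have [j /andP[aj jb] [eaj ejb]] := apex ab1 eab.
have tT : in_triangles T (tmap a j b : representable n 2).
  exists (a, j, b); first by rewrite inE /= aj jb eaj ejb eab.
  by move=> k; rewrite !inE /tmap; do 2?case: ifP; rewrite eqxx ?orbT.
pose t : tri_symset T 2 := exist _ _ tT.
have tE k l : sval (edge k l t) = emap (tmap a j b k) (tmap a j b l).
  by apply: funext => q; rewrite /= /emap; case: (q == ord0).
have fE k l : edge k l (f 2 t) = f 1 (edge k l t) by rewrite /edge symapp_restr.
have [|l [wl rl ll]] := IH a j (edge ord0 mid t) _ aj eaj (tE _ _); first by lia.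
have [|r [wr rr lr]] := IH j b (edge mid ord_max t) _ jb ejb (tE _ _); first by lia.
exists (Node (f 2 t) l r); split=> /=.
- by rewrite !fE rl rr.
- by rewrite fE; congr (f 1 _); apply: tri_symset_eq; rewrite tE yab.
- rewrite ll lr -map_cat; congr map.
  by rewrite -{2}(subnKC (ltnW aj)) -iotaD; congr iota; lia.
Qed.

End Boundary.

Lemma spine_edge_subproof n (i : 'I_n) :
  in_spine (emap (widen_ord (leqnSn n) i) (lift ord0 i) : representable n 1).
Proof. by exists i => k; rewrite /emap; case: ifP => _; [left|right]. Qed.

Definition spine_edge n (i : 'I_n) : spine n 1 := exist _ _ (spine_edge_subproof i).

Lemma long_edges_pastings n (T T' : triangulation n) (X : symset)
    (f : symmap (glued_triangulations T T') X) :
  exists P Q : pasting X, [/\ wf P, wf Q, leaves P = leaves Q,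
    root P = f 1 (long_edge_l T T') & root Q = f 1 (long_edge_r T T')].
Proof.
have n0 : 0 < n by have := polygon_size T; lia.
(* The reduction mod n only serves to make the side total in k. *)
pose i_ k : 'I_n := Ordinal (ltn_pmod k n0).
pose inl_ := pushout_inl (spine_incl T) (spine_incl T').
pose inr_ := pushout_inr (spine_incl T) (spine_incl T').
pose s k : X 1 := f 1 (inl_ 1 (spine_incl T 1 (spine_edge (i_ k)))).
have spineE (i j : 'I_n.+1) : j = i.+1 :> nat -> emap i j = sval (spine_edge (i_ i)).
  move=> ji; have lti : i < n by rewrite -ltnS -ji.
  by congr emap; apply: val_inj; rewrite /= modn_small.
have long U : tri_edge U (@ord0 n) (@ord_max n).
  by rewrite /tri_edge /side /= !eqxx orbT.
have [|P [wfP rP lP]] := @triangulation_pasting n T X (symcomp f inl_) s _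
  ord0 ord_max (long_edge T) n0 (long T) erefl.
  move=> i j y ji yij /=; rewrite /s; congr (f 1 (inl_ 1 _)); apply: tri_symset_eq.
  by rewrite yij (spineE _ _ ji).
have [|Q [wfQ rQ lQ]] := @triangulation_pasting n T' X (symcomp f inr_) s _
  ord0 ord_max (long_edge T') n0 (long T') erefl.
  move=> i j y ji yij /=; rewrite /s; congr (f 1 _).
  rewrite -[inl_ 1 _]/(symcomp inl_ (spine_incl T) 1 _) pushout_square /=.
  by congr (inr_ 1 _); apply: tri_symset_eq; rewrite yij (spineE _ _ ji).
by exists P, Q; rewrite lP lQ.
Qed.

Lemma walk_ends (X : symset) x y x' y' (w : seq (X 1)) :
  0 < size w -> walk x w y -> walk x' w y' -> x = x' /\ y = y'.
Proof.
elim: w x x' => // e [_ x x' _ /= [<- <-] [<- <-]//|e' w IH] x x' _ [<- w1] [<- w2].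
by have [] := IH _ _ isT w1 w2.
Qed.

(** * The unit of the adjunction on edges *)

Lemma arrow_tau_unit (X : symset) n (s : X n) i j x y (e : edge_between x y) :
  sval e = edge i j s ->
  Arrow (fmor (tau_unit X n s) (tt : @gmor (codiscrete _) i j)) = Arrow (tau_edge e).
Proof. by move=> ee; apply: tau_edge_arrow. Qed.

Lemma ginv_unique (G : groupoid) (a b : G) (h : gmor a b) (k : gmor b a) :
  gcomp h k = gid a -> k = ginv h.
Proof.
by move=> hk; rewrite -[k]gcomp_idl -(gcomp_invl h) -gcompA hk gcomp_idr.
Qed.

(** The three other arrows of the functor are an inverse and two identities. *)
Lemma nerve_edge_eq (G : groupoid) (F F' : nerve G 1) :
  Arrow (fmor F (tt : @gmor (codiscrete _) ord0 ord_max)) =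
  Arrow (fmor F' (tt : @gmor (codiscrete _) ord0 ord_max)) -> F = F'.
Proof.
move=> FF.
pose u (i j : 'I_2) : @gmor (codiscrete 'I_2) i j := tt.
have inv (H : nerve G 1) (i j : 'I_2) : fmor H (u j i) = ginv (fmor H (u i j)).
  apply: ginv_unique; rewrite -fmor_comp.
  exact: (fmor_id H i).
have ord2 (i : 'I_2) : i = ord0 \/ i = ord_max.
  by case: i => [[|[|//]] lti]; [left|right]; apply: val_inj.
have o0 := congr1 (@arr_src G) FF; have o1 := congr1 (@arr_tgt G) FF.
have idE (i : 'I_2) : F i = F' i ->
    Arrow (fmor F (u i i)) = Arrow (fmor F' (u i i)).
  by rewrite (fmor_id F i) (fmor_id F' i) => ->.
apply: functor_eq => i j []; rewrite -/(u i j).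
case: (ord2 i) => ->; case: (ord2 j) => ->; try exact: idE; first exact: FF.
by rewrite (inv F) (inv F') (congr1 (fun A => Arrow (ginv (arr_mor A))) FF).
Qed.

Lemma tau_unit_pastings (X : symset) (P Q : pasting X) :
  wf P -> wf Q -> leaves P = leaves Q ->
  tau_unit X 1 (root P) = tau_unit X 1 (root Q).
Proof.
move=> wfP wfQ PQ; have wP := walk_leaves wfP.
have wQ := walk_leaves wfQ; rewrite PQ in wP.
have [sPQ tPQ] := walk_ends (size_leaves_gt0 Q) wQ wP.
pose e : edge_between _ _ := exist _ (root P) (conj erefl erefl).
pose g : edge_between (source (root P)) (target (root P)) :=
  exist _ (root Q) (conj sPQ tPQ).
apply: nerve_edge_eq; rewrite (@arrow_tau_unit _ _ _ _ _ _ _ e) ?edge_id //.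
rewrite (@arrow_tau_unit _ _ _ _ _ _ _ g) ?edge_id //.
by congr Arrow; apply/tau_edge_eqP; exists P, Q.
Qed.

(** The maps from a standard simplex detect the difference of two simplices. *)
Lemma monomorphism_inj (X Y : symset) (f : symmap X Y) n :
  monomorphism f -> injective (f n).
Proof.
move=> mono x y fxy.
have yr (z : X n) l m (h : 'I_l.+1 -> 'I_m.+1) (s : representable n m) :
  restr (restr h s) z = restr h (restr s z) by exact: restr_comp.
pose yo (z : X n) : symmap (representable n) X := SymMap (yr z).
have yoxy : yo x = yo y.
  by apply: mono; apply: symmap_eq => m s /=; rewrite !symapp_restr fxy.
have := congr1 (fun g : symmap (representable n) X => g n (fun i => i)) yoxy.
by rewrite /= !restr_id.
Qed.

Lemma arrow_tau_unit_inj (X : symset) n m (s : X n) (s' : X m) i j i' j' :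
  Arrow (tau_edge (mk_edge i j s)) = Arrow (tau_edge (mk_edge i' j' s')) ->
  exists P Q : pasting X, [/\ wf P, wf Q, leaves P = leaves Q,
    root P = edge i j s & root Q = edge i' j' s'].
Proof.
have gen x y (e : edge_between x y) x' y' (e' : edge_between x' y') :
    Arrow (tau_edge e) = Arrow (tau_edge e') ->
    exists P Q : pasting X, [/\ wf P, wf Q, leaves P = leaves Q,
      root P = sval e & root Q = sval e'].
  move=> ee; have ex := congr1 (@arr_src _) ee; have ey := congr1 (@arr_tgt _) ee.
  move: ex ey; rewrite /= => ex ey; case: _ / ex e' ee; case: _ / ey => e' ee.
  by apply/tau_edge_eqP; apply: arrow_inj.
exact: gen.
Qed.

Theorem proposition13 (X : partial_groupoid) :
  embeddable X <->
  (forall (n : nat) (T T' : triangulation n) (c : compatible T T')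
     (f : symmap (NA c) X),
     f 1 (long_edge_l T T') = f 1 (long_edge_r T T')).
Proof.
split=> [emb n T T' c f|long].
  have [P [Q [wfP wfQ PQ <- <-]]] := long_edges_pastings f.
  exact/(monomorphism_inj emb)/tau_unit_pastings.
have inj n : injective (tau_unit X n).
  move=> x y xy; apply: simplex_eq => i j.
  have /arrow_tau_unit_inj[P [Q [wfP wfQ PQ <- <-]]] :
      Arrow (tau_edge (mk_edge i j x)) = Arrow (tau_edge (mk_edge i j y)).
    exact: (congr1 (fun F : nerve (tau X) n =>
      Arrow (fmor F (tt : @gmor (codiscrete _) i j))) xy).
  exact: root_same_leaves.
move=> Z g h gh; apply: symmap_eq => n z; apply: inj.
exact: (congr1 (fun k : symmap Z _ => k n z) gh).
Qed.
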